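(* Let $\mathcal{C}(\mathcal{Z})$ be the discrete cluster category associated to an admissible subset $\mathcal{Z}\subseteq S^1$ with limit points $a_1<\dots<a_n$, $n\ge2$. Let $(\mathcal{X},\mathcal{Y})$ be a t-structure in $\mathcal{C}(\mathcal{Z})$, with aisle $\mathcal{X}=\mathcal{X}(\mathcal{P},\mathbf{x})$ corresponding to the $\overline{\mathcal{Z}}$-decorated non-crossing partition $(\mathcal{P},\mathbf{x})$ with decoration $\mathbf{x}=(x_1,\ldots,x_n)$. For $i=1,\ldots,n$ set $y_i=x_i^-$ if $x_i\in\mathcal{Z}$ and $y_i=x_i$ otherwise, and let $\mathcal{P}^c=\{B'_m\mid m\in I'\}$ be the Kreweras complement of $\mathcal{P}$. Then $$\mathcal{Y}=\mathrm{add}\,\Big\{\{z_0,z_1\}\text{ arc of }\mathcal{Z}\;\Big|\;z_0,z_1\in\bigcup_{i\in B'_m}[y_i,a_{i+1})\text{ for some }m\in I'\Big\}.$$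
   Context: **Combinatorial setting.** $\mathbb{K}$ is a field. $S^1$ is the unit circle with anti-clockwise cyclic order: for pairwise distinct $x,y,z\in S^1$, $x<y<z$ means that going anti-clockwise one meets first $x$, then $y$, then $z$; for $m\ge 3$, $x_1<\dots<x_m$ means $x_i<x_{i+1}<x_{i+2}$ for all $i$ (indices modulo $m$). $\mathcal{Z}\subseteq S^1$ is admissible: discrete, infinite, with set of limit points $L(\mathcal{Z})=\overline{\mathcal{Z}}\setminus\mathcal{Z}$ ($\overline{\mathcal{Z}}$ the topological closure) finite of cardinality $n$ (here $n\geq 2$), every limit point being a two-sided limit point. The limit points are $a_1<\dots<a_n$, indices modulo $n$ (so $a_{n+1}=a_1$). For $a,b\in\overline{\mathcal{Z}}$, $(a,b)=\{c\in\overline{\mathcal{Z}}\mid a<c<b\}$, and $[a,b],[a,b),(a,b]$ are defined analogously as subsets of $\overline{\mathcal{Z}}$; $(a,a]=[a,a)=\varnothing$. Each $z\in\mathcal{Z}$ has an immediate successor $z^+$ and predecessor $z^-$ in $\mathcal{Z}$ (anti-clockwise, resp. clockwise neighbour). An arc of $\mathcal{Z}$ is a 2-element subset $\{z_0,z_1\}\subseteq\mathcal{Z}$ with $z_1\notin\{z_0^-,z_0,z_0^+\}$. Arcs $\{y_0,y_1\},\{y_0',y_1'\}$ cross if $y_0<y_0'<y_1<y_1'$ or $y_0<y_1'<y_1<y_0'$. **The category.** $\mathcal{C}(\mathcal{Z})$ is the discrete cluster category of Igusa–Todorov: a $\mathbb{K}$-linear, 2-Calabi–Yau, Krull–Schmidt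 triangulated category with suspension $\Sigma$ whose non-zero indecomposable objects correspond to arcs of $\mathcal{Z}$ (same notation for arc and object), with: - $\Sigma\{y_0,y_1\}=\{y_0^-,y_1^-\}$; - $\mathrm{Hom}(\{y_0,y_1\},\Sigma\{y_0',y_1'\})=\mathbb{K}$ if the arcs $\{y_0,y_1\}$ and $\{y'_0,y'_1\}$ cross, and $0$ otherwise; - a non-zero morphism $\{y_0,y_1\}\to\{y_0',y_1'\}$ with $y_0<y_0'^+<y_1<y_1'^+$ factors through an indecomposable $S$ iff $S=\{s_0,s_1\}$ with $y_0\le s_0\le y_0'$ and $y_1\le s_1\le y_1'$; - if $y_0<y_0'<y_1<y_1'$, every non-zero $f:\{y_0,y_1\}\to\Sigma\{y_0',y_1'\}$ sits in a triangle $\{y_0',y_1'\}\to X\oplus Z\to\{y_0,y_1\}\xrightarrow{f}\Sigma\{y_0',y_1'\}$ with $X=\{y_0,y_0'\}$, $Z=\{y_1,y_1'\}$ (read as $0$ when not an arc); the components of the first two maps to and from $X$, $Z$ are non-zero when the corresponding objects are non-zero. All subcategories are full and closed under direct sums and summands; $\mathrm{add}(\mathcal{Y})$ is the smallest such subcategory containing the set of arcs $\mathcal{Y}$. **t-structures.** A torsion pair in a triangulated category $\mathcal{T}$ is a pair $(\mathcal{X},\mathcal{Y})$ of subcategories closed under direct summands with $\mathrm{Hom}(X,Y)=0$ for $X\in\mathcal{X},Y\in\mathcal{Y}$ and such that every $T\in\mathcal{T}$ has a distinguished triangle $X\to T\to Y\to\Sigma X$ with $X\in\mathcal{X},Y\in\mathcal{Y}$.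 A t-structure is a torsion pair with $\Sigma\mathcal{X}\subseteq\mathcal{X}$; $\mathcal{X}$ is its aisle, $\mathcal{Y}=\mathcal{X}^\perp$ its coaisle. **Decorated partitions.** A non-crossing partition $\mathcal{P}=\{B_m\mid m\in I\}$ of $[n]=\{1,\dots,n\}$ is a partition of $[n]$ into non-empty blocks such that whenever $i<k<j<l$ with $i,j\in B_{m_1}$, $k,l\in B_{m_2}$, then $m_1=m_2$. $i$ is a singleton of $\mathcal{P}$ if $\{i\}\in\mathcal{P}$; $i$ is an adjacency of $\mathcal{P}$ if $i$ and $i+1$ (cyclically modulo $n$) are in the same block. A $\overline{\mathcal{Z}}$-decoration of $\mathcal{P}$ is a tuple $\mathbf{x}=(x_1,\ldots,x_n)$ with $x_i\in[a_i,a_{i+1})$ if $i$ is a singleton, $x_i\in(a_i,a_{i+1}]$ if $i$ is an adjacency, and $x_i\in(a_i,a_{i+1})$ otherwise. Set $$\mathcal{X}(\mathcal{P},\mathbf{x})=\mathrm{add}\{\{y_0,y_1\}\text{ arc of }\mathcal{Z}\mid y_0,y_1\in\textstyle\bigcup_{i\in B}(a_i,x_i]\text{ for some }B\in\mathcal{P}\}.$$ The assignment $(\mathcal{P},\mathbf{x})\mapsto\mathcal{X}(\mathcal{P},\mathbf{x})$ is a bijection from $\overline{\mathcal{Z}}$-decorated non-crossing partitions of $[n]$ to aisles of t-structures in $\mathcal{C}(\mathcal{Z})$. **Kreweras complement.** Consider the linearly ordered set $1<1'<2<2'<\dots<n<n'$. View $\mathcal{P}$ as a collection of blocks on $\{1,\dots,n\}$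 in it. There is a unique maximal (coarsest) non-crossing partition $\tilde{\mathcal{P}}$ of this $2n$-element set containing all blocks of $\mathcal{P}$ as blocks; the remaining blocks $\tilde{\mathcal{P}}\setminus\mathcal{P}$ form a non-crossing partition of $\{1',\dots,n'\}\cong[n]$, denoted $\mathcal{P}^c$ (with $i'$ identified with $i$). *)

(* Defs.v *)
From HB Require Import structures.
From mathcomp Require Import all_boot all_order all_algebra.

Set Implicit Arguments.
Unset Strict Implicit.
Unset Printing Implicit Defensive.

Import Order.TTheory GRing.Theory Num.Theory.
Local Open Scope ring_scope.

(* Indices i = 1, ..., n are represented by 'I_n; cyclic indices i + 1 mod n
   are given by ordS i. *)

Definition noncrossing (m : nat) (P : {set {set 'I_m}}) : bool :=
  finset.partition P [set: 'I_m]
  && [forall B1 in P, forall B2 in P,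
      forall i in B1, forall j in B1, forall k in B2, forall l in B2,
      [&& (i < k)%N, (k < j)%N & (j < l)%N] ==> (B1 == B2)].

Definition is_singleton (n : nat) (P : {set {set 'I_n}}) (i : 'I_n) : bool :=
  [set i] \in P.

Definition is_adjacency (n : nat) (P : {set {set 'I_n}}) (i : 'I_n) : bool :=
  [exists B in P, (i \in B) && (ordS i \in B)].

(* The chain 1 < 1' < 2 < 2' < ... < n < n' is 'I_n.*2: i and i' are sent to
   the positions 2i and 2i + 1 (counting from 0). *)
Lemma unprimed_subproof (n : nat) (i : 'I_n) : (i.*2 < n.*2)%N.
Proof. by rewrite ltn_double. Qed.

Lemma primed_subproof (n : nat) (i : 'I_n) : (i.*2.+1 < n.*2)%N.
Proof. by rewrite ltn_Sdouble. Qed.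

Definition unprimed (n : nat) (i : 'I_n) : 'I_n.*2 :=
  Ordinal (unprimed_subproof i).

Definition primed (n : nat) (i : 'I_n) : 'I_n.*2 :=
  Ordinal (primed_subproof i).

Definition unprimed_blocks (n : nat) (P : {set {set 'I_n}}) :
    {set {set 'I_n.*2}} :=
  [set [set unprimed i | i in B] | B : {set 'I_n} in P].

Definition extends_blocks (n : nat) (P : {set {set 'I_n}})
    (Q : {set {set 'I_n.*2}}) : bool :=
  noncrossing Q && (unprimed_blocks P \subset Q).

Definition refines (m : nat) (P Q : {set {set 'I_m}}) : bool :=
  [forall A in P, exists B in Q, A \subset B].

Definition coarsest_extension (n : nat) (P : {set {set 'I_n}})
    (Q : {set {set 'I_n.*2}}) : bool :=
  extends_blocks P Q
  && [forall Q' : {set {set 'I_n.*2}}, extends_blocks P Q' ==> refines Q' Q].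

(* The default value set0 is irrelevant: the coarsest extension exists (and is
   unique) as soon as P is a non-crossing partition. *)
Definition kreweras (n : nat) (P : {set {set 'I_n}}) : {set {set 'I_n}} :=
  if [pick Q | coarsest_extension P Q] is Some Q then
    [set [set i | primed i \in B] | B : {set 'I_n.*2} in Q :\: unprimed_blocks P]
  else set0.

(* K-linear categories with finite-dimensional morphism spaces. *)
Record linear_category (K : fieldType) := LinearCategory {
  obj :> Type;
  hom : obj -> obj -> vectType K;
  idm : forall X, hom X X;
  comp : forall X Y Z, hom Y Z -> hom X Y -> hom X Z;
  compA : forall X Y Z W (h : hom Z W) (g : hom Y Z) (f : hom X Y),
    comp h (comp g f) = comp (comp h g) f;
  comp1m : forall X Y (f : hom X Y), comp (idm Y) f = f;
  compm1 : forall X Y (f : hom X Y), comp f (idm X) = f;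
  comp_linear_r : forall X Y Z (g : hom Y Z) (c : K) (f f' : hom X Y),
    comp g (c *: f + f') = c *: comp g f + comp g f';
  comp_linear_l : forall X Y Z (f : hom X Y) (c : K) (g g' : hom Y Z),
    comp (c *: g + g') f = c *: comp g f + comp g' f
}.

Arguments hom {K l}.
Arguments idm {K l}.
Arguments comp {K l X Y Z}.

Declare Scope cat_scope.
Notation "g ⊚ f" := (comp g f) (at level 40, left associativity) : cat_scope.
Local Open Scope cat_scope.

Section LinearCategoryTheory.
Context {K : fieldType} {C : linear_category K}.

Definition is_iso (X Y : C) (f : hom X Y) : Prop :=
  exists g : hom Y X, g ⊚ f = idm X /\ f ⊚ g = idm Y.

Definition isomorphic (X Y : C) : Prop := exists f : hom X Y, is_iso f.

Definition is_zero (X : C) : Prop :=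
  forall Y : C, (forall f : hom X Y, f = 0) /\ (forall f : hom Y X, f = 0).

Definition biproduct (W X Y : C) (i1 : hom X W) (p1 : hom W X)
    (i2 : hom Y W) (p2 : hom W Y) : Prop :=
  [/\ p1 ⊚ i1 = idm X, p2 ⊚ i2 = idm Y, p1 ⊚ i2 = 0, p2 ⊚ i1 = 0
    & i1 ⊚ p1 + i2 ⊚ p2 = idm W].

Definition is_dsum2 (W X Y : C) : Prop :=
  exists (i1 : hom X W) (p1 : hom W X) (i2 : hom Y W) (p2 : hom W Y),
    biproduct i1 p1 i2 p2.

Definition is_dsum (m : nat) (W : C) (X : 'I_m -> C) : Prop :=
  exists (inj : forall i, hom (X i) W) (prj : forall i, hom W (X i)),
    [/\ forall i, prj i ⊚ inj i = idm (X i),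
        forall i j, i != j -> prj i ⊚ inj j = 0
      & \sum_i inj i ⊚ prj i = idm W].

Definition indecomposable (X : C) : Prop :=
  ~ is_zero X /\ forall Y Z : C, is_dsum2 X Y Z -> is_zero Y \/ is_zero Z.

(* The endomorphism ring of X is local: it is non-zero and its non-units are
   closed under addition. *)
Definition local_end (X : C) : Prop :=
  idm X <> 0
  /\ forall f g : hom X X, is_iso (f + g) -> is_iso f \/ is_iso g.

Definition krull_schmidt : Prop :=
  forall X : C, exists (m : nat) (U : 'I_m -> C),
    is_dsum X U /\ forall i, local_end (U i).

Definition subcategory (S : C -> Prop) : Prop :=
  [/\ forall X, is_zero X -> S X,
      forall W X Y, is_dsum2 W X Y -> S X -> S Y -> S W
    & forall W X Y, is_dsum2 W X Y -> S W -> S X].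

End LinearCategoryTheory.

Arguments krull_schmidt {K} C.

Record triangulated_category (K : fieldType) := TriangulatedCategory {
  tcat :> linear_category K;
  zero_ex : exists O : tcat, is_zero O;
  dsum2_ex : forall X Y : tcat, exists W, is_dsum2 W X Y;
  (* the suspension, a K-linear autoequivalence *)
  sh : tcat -> tcat;
  shm : forall X Y : tcat, {linear hom X Y -> hom (sh X) (sh Y)};
  shm1 : forall X, shm X X (idm X) = idm (sh X);
  shmM : forall X Y Z (g : hom Y Z) (f : hom X Y),
    shm X Z (g ⊚ f) = shm Y Z g ⊚ shm X Y f;
  shm_bij : forall X Y, bijective (shm X Y);
  sh_surj : forall Y, exists X, isomorphic (sh X) Y;
  triangle : forall X Y Z, hom X Y -> hom Y Z -> hom Z (sh X) -> Prop;
  triangle_iso : forall X Y Z (f : hom X Y) (g : hom Y Z) (h : hom Z (sh X))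
      X' Y' Z' (f' : hom X' Y') (g' : hom Y' Z') (h' : hom Z' (sh X'))
      (u : hom X X') (v : hom Y Y') (w : hom Z Z'),
    is_iso u -> is_iso v -> is_iso w ->
    v ⊚ f = f' ⊚ u -> w ⊚ g = g' ⊚ v -> shm X X' u ⊚ h = h' ⊚ w ->
    triangle f g h -> triangle f' g' h';
  triangle_id : forall X O, is_zero O ->
    triangle (idm X) (0 : hom X O) (0 : hom O (sh X));
  triangle_ex : forall X Y (f : hom X Y),
    exists Z (g : hom Y Z) (h : hom Z (sh X)), triangle f g h;
  triangle_rot : forall X Y Z (f : hom X Y) (g : hom Y Z) (h : hom Z (sh X)),
    triangle f g h <-> triangle g h (- shm X Y f);
  triangle_mor : forall X Y Z (f : hom X Y) (g : hom Y Z) (h : hom Z (sh X))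
      X' Y' Z' (f' : hom X' Y') (g' : hom Y' Z') (h' : hom Z' (sh X'))
      (u : hom X X') (v : hom Y Y'),
    triangle f g h -> triangle f' g' h' -> v ⊚ f = f' ⊚ u ->
    exists w : hom Z Z', w ⊚ g = g' ⊚ v /\ shm X X' u ⊚ h = h' ⊚ w;
  triangle_oct : forall X Y Z (f : hom X Y) (g : hom Y Z)
      F (f1 : hom Y F) (f2 : hom F (sh X))
      G (g1 : hom Z G) (g2 : hom G (sh Y))
      H (h1 : hom Z H) (h2 : hom H (sh X)),
    triangle f f1 f2 -> triangle g g1 g2 -> triangle (g ⊚ f) h1 h2 ->
    exists (u : hom F H) (v : hom H G),
      [/\ triangle u v (shm Y F f1 ⊚ g2),
          u ⊚ f1 = h1 ⊚ g, h2 ⊚ u = f2,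
          v ⊚ h1 = g1 & g2 ⊚ v = shm X Y f ⊚ h2]
}.

Arguments sh {K t}.
Arguments shm {K t X Y}.
Arguments triangle {K t X Y Z}.

Section TriangulatedCategoryTheory.
Context {K : fieldType} (C : triangulated_category K).

(* Bifunctorial isomorphisms between Hom(X, Y) and the K-dual of
   Hom(Y, sh (sh X)). *)
Definition calabi_yau2 : Prop :=
  exists phi : forall X Y : C,
      {linear hom X Y -> 'Hom(hom Y (sh (sh X)), K^o)},
    [/\ forall X Y, bijective (phi X Y),
        forall X Y Y' (f : hom X Y) (k : hom Y Y') (g : hom Y' (sh (sh X))),
          phi X Y' (k ⊚ f) g = phi X Y f (g ⊚ k)
      & forall X X' Y (f : hom X Y) (k : hom X' X) (g : hom Y (sh (sh X'))),
          phi X' Y (f ⊚ k) g = phi X Y f (shm (shm k) ⊚ g)].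

Definition torsion_pair (X Y : C -> Prop) : Prop :=
  [/\ subcategory X, subcategory Y,
      forall S T, X S -> Y T -> forall f : hom S T, f = 0
    & forall T, exists S U (f : hom S T) (g : hom T U) (h : hom U (sh S)),
        [/\ X S, Y U & triangle f g h]].

Definition t_structure (X Y : C -> Prop) : Prop :=
  torsion_pair X Y /\ forall T, X T -> X (sh T).

End TriangulatedCategoryTheory.

From mathcomp Require Import all_classical all_reals all_analysis.
Import numFieldNormedType.Exports.
Local Open Scope classical_set_scope.

Section Circle.
Context {R : realType}.
Local Notation pt := (R * R)%type.

Definition circle : set pt := [set p | p.1 ^+ 2 + p.2 ^+ 2 = 1].

Definition cis (t : R) : pt := (cos t, sin t).

(* x < y < z in the cyclic order: turning anti-clockwise from x by less than a
   full turn, one meets y and then z. *)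
Definition ccw (x y z : pt) : Prop :=
  exists t u v : R,
    [/\ x = cis t, y = cis (t + u), z = cis (t + v) &
        [/\ 0 < u, u < v & v < 2 * pi]].

Definition ccw4 (x y z w : pt) : Prop :=
  [/\ ccw x y z, ccw y z w, ccw z w x & ccw w x y].

(* a_1 < ... < a_n.  For n >= 5, requiring a_i < a_(i+1) < a_(i+2) for cyclically
   consecutive indices only would allow a to wind several times around the
   circle. *)
Definition cyclically_ordered (n : nat) (a : 'I_n -> pt) : Prop :=
  injective a
  /\ forall i j k : 'I_n, (i < j)%N -> (j < k)%N -> ccw (a i) (a j) (a k).

Variable Z : set pt.

Definition limit_points : set pt := closure Z `\` Z.

(* The points of Z accumulate at p from both sides. *)
Definition two_sided (p : pt) : Prop :=
  forall t : R, p = cis t -> forall e : R, 0 < e ->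
    (exists2 u : R, 0 < u < e & Z (cis (t + u)))
    /\ (exists2 u : R, 0 < u < e & Z (cis (t - u))).

Definition admissible : Prop :=
  [/\ Z `<=` circle, Z `<=` isolated Z, infinite_set Z,
      finite_set limit_points & limit_points `<=` two_sided].

Definition int_oo (a b : pt) : set pt := [set c | closure Z c /\ ccw a c b].

(* The clauses a <> b implement the convention (a, a] = [a, a) = set0. *)
Definition int_oc (a b : pt) : set pt :=
  [set c | [/\ closure Z c, a <> b & ccw a c b \/ c = b]].

Definition int_co (a b : pt) : set pt :=
  [set c | [/\ closure Z c, a <> b & ccw a c b \/ c = a]].

Definition int_cc (a b : pt) : set pt :=
  [set c | closure Z c /\ [\/ ccw a c b, c = a | c = b]].

(* The neighbours z^+ and z^- in Z of z in Z; the default value z is never taken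
   when Z is admissible. *)
Definition succ_in (z : pt) : pt :=
  xget z [set w | [/\ Z w, w <> z & forall u, Z u -> ~ ccw z u w]].

Definition pred_in (z : pt) : pt :=
  xget z [set w | [/\ Z w, w <> z & forall u, Z u -> ~ ccw w u z]].

Definition is_arc (z0 z1 : pt) : Prop :=
  [/\ Z z0, Z z1 & [/\ z1 <> pred_in z0, z1 <> z0 & z1 <> succ_in z0]].

Definition arcs : set (set pt) :=
  [set A | exists z0 z1, is_arc z0 z1 /\ A = [set z0; z1]].

Definition crossing (y0 y1 y0' y1' : pt) : Prop :=
  ccw4 y0 y0' y1 y1' \/ ccw4 y0 y1' y1 y0'.

Definition decoration (n : nat) (a : 'I_n -> pt) (P : {set {set 'I_n}})
    (x : 'I_n -> pt) : Prop :=
  forall i : 'I_n,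
    if is_singleton P i then int_co (a i) (a (ordS i)) (x i)
    else if is_adjacency P i then int_oc (a i) (a (ordS i)) (x i)
    else int_oo (a i) (a (ordS i)) (x i).

(* The arcs with both endpoints in the union of the sets J i, i in B, for some
   block B of P. *)
Definition arcs_in_blocks (n : nat) (P : {set {set 'I_n}})
    (J : 'I_n -> set pt) : set (set pt) :=
  [set A | arcs A /\
           exists2 B, B \in P & A `<=` \bigcup_(i in [set` B]) J i].

End Circle.

(* C(Z) is described by its structure of K-linear triangulated category together
   with its known properties in terms of arcs.  The function arc_obj is total;
   it sends sets which are not arcs to zero objects. *)
Record discrete_cluster_category (R : realType) (Z : set (R * R)%type)
    (K : fieldType) := DiscreteClusterCategory {
  dcat :> triangulated_category K;
  dcat_cy2 : calabi_yau2 dcat;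
  dcat_ks : krull_schmidt dcat;
  arc_obj : set (R * R)%type -> dcat;
  arc_obj_indec : forall A, arcs Z A -> indecomposable (arc_obj A);
  arc_obj_inj : forall A A', arcs Z A -> arcs Z A' ->
    isomorphic (arc_obj A) (arc_obj A') -> A = A';
  arc_obj_surj : forall T : dcat, indecomposable T ->
    exists2 A, arcs Z A & isomorphic T (arc_obj A);
  arc_obj0 : forall A, ~ arcs Z A -> is_zero (arc_obj A);
  arc_obj_sh : forall y0 y1, is_arc Z y0 y1 ->
    isomorphic (sh (arc_obj [set y0; y1]))
               (arc_obj [set pred_in Z y0; pred_in Z y1]);
  hom_crossing : forall y0 y1 y0' y1', is_arc Z y0 y1 -> is_arc Z y0' y1' ->
    crossing y0 y1 y0' y1' ->
    \dim {: hom (arc_obj [set y0; y1]) (sh (arc_obj [set y0'; y1']))} = 1%N;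
  hom_not_crossing : forall y0 y1 y0' y1',
    is_arc Z y0 y1 -> is_arc Z y0' y1' -> ~ crossing y0 y1 y0' y1' ->
    \dim {: hom (arc_obj [set y0; y1]) (sh (arc_obj [set y0'; y1']))} = 0%N;
  arc_factor : forall y0 y1 y0' y1', is_arc Z y0 y1 -> is_arc Z y0' y1' ->
    ccw4 y0 (succ_in Z y0') y1 (succ_in Z y1') ->
    forall f : hom (arc_obj [set y0; y1]) (arc_obj [set y0'; y1']), f <> 0 ->
    forall S, arcs Z S ->
      (exists (g : hom (arc_obj [set y0; y1]) (arc_obj S))
              (h : hom (arc_obj S) (arc_obj [set y0'; y1'])), f = h ⊚ g)
      <-> (exists s0 s1, [/\ S = [set s0; s1], int_cc Z y0 y0' s0
                           & int_cc Z y1 y1' s1]);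
  arc_triangle : forall y0 y1 y0' y1', is_arc Z y0 y1 -> is_arc Z y0' y1' ->
    ccw4 y0 y0' y1 y1' ->
    let A := arc_obj [set y0; y1] in
    let A' := arc_obj [set y0'; y1'] in
    let E1 := arc_obj [set y0; y0'] in
    let E2 := arc_obj [set y1; y1'] in
    forall f : hom A (sh A'), f <> 0 ->
    exists (W : dcat) (i1 : hom E1 W) (p1 : hom W E1)
           (i2 : hom E2 W) (p2 : hom W E2) (u : hom A' W) (v : hom W A),
      [/\ biproduct i1 p1 i2 p2, triangle u v f,
          arcs Z [set y0; y0'] -> p1 ⊚ u <> 0 /\ v ⊚ i1 <> 0
        & arcs Z [set y1; y1'] -> p2 ⊚ u <> 0 /\ v ⊚ i2 <> 0]
}.

Arguments arc_obj {R Z K}.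

(* add(Ys), the smallest subcategory containing the arcs of Ys. *)
Definition add_arcs (R : realType) (Z : set (R * R)%type) (K : fieldType)
    (C : discrete_cluster_category Z K) (Ys : set (set (R * R)%type)) :
    C -> Prop :=
  fun T => forall S : C -> Prop, subcategory S ->
    (forall A, Ys A -> S (arc_obj C A)) -> S T.

(* Main.v *)
From mathcomp Require Import all_boot all_order all_algebra ring lra zify.
Require Import Defs.

(* The coaisle is the right orthogonal of the aisle, and by the Krull-Schmidt
   property it is determined by its arcs.  As {z0, z1} = sh {z0^+, z1^+}, an arc
   {z0, z1} lies in the coaisle iff {z0^+, z1^+} crosses no arc of the aisle.
   Cut the circle open at a limit point, so that points become angles in [0, 2 pi)
   and {s0, s1} crosses {w0, w1} iff the parity of #{k | s < w_k} changes from
   s = s0 to s = s1.  If w_k lies in the i_k-th segment, the arc joining w_k^- to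
   w_k^+ forces w_k to be beyond the decoration x_(i_k); then for s below the
   decoration of the j-th segment, s < w_k means j <= i_k, and the absence of
   crossings says that no block of P separates i_0' from i_1', that is, that i_0
   and i_1 are in the same block of the Kreweras complement. *)

Set Implicit Arguments.
Unset Strict Implicit.
Unset Printing Implicit Defensive.

Import Order.TTheory GRing.Theory Num.Theory.
Local Open Scope cat_scope.

(** * Linear and triangulated categories *)

Section LinearCategory.
Local Open Scope ring_scope.
Context {K : fieldType} {C : linear_category K}.
Implicit Types X Y Z W O : C.

Lemma compD X Y Z (g : Defs.hom Y Z) (f f' : Defs.hom X Y) :
  g ⊚ (f + f') = g ⊚ f + g ⊚ f'.
Proof. by have := comp_linear_r g 1 f f'; rewrite !scale1r. Qed.

Lemma compDl X Y Z (f : Defs.hom X Y) (g g' : Defs.hom Y Z) :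
  (g + g') ⊚ f = g ⊚ f + g' ⊚ f.
Proof. by have := comp_linear_l f 1 g g'; rewrite !scale1r. Qed.

Lemma comp0 X Y Z (g : Defs.hom Y Z) : g ⊚ (0 : Defs.hom X Y) = 0.
Proof. by apply: (@addrI _ (g ⊚ 0)); rewrite -compD !addr0. Qed.

Lemma comp0l X Y Z (f : Defs.hom X Y) : (0 : Defs.hom Y Z) ⊚ f = 0.
Proof. by apply: (@addrI _ (0 ⊚ f)); rewrite -compDl !addr0. Qed.

Lemma compN X Y Z (g : Defs.hom Y Z) (f : Defs.hom X Y) : g ⊚ (- f) = - (g ⊚ f).
Proof. by apply: (@addrI _ (g ⊚ f)); rewrite -compD !addrN comp0. Qed.

Lemma compNl X Y Z (g : Defs.hom Y Z) (f : Defs.hom X Y) : (- g) ⊚ f = - (g ⊚ f).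
Proof. by apply: (@addrI _ (g ⊚ f)); rewrite -compDl !addrN comp0l. Qed.

Lemma is_zero_id X : idm X = 0 -> is_zero X.
Proof.
move=> X0 Y; split=> f; first by rewrite -(compm1 f) X0 comp0.
by rewrite -(comp1m f) X0 comp0l.
Qed.

Lemma isomorphic_sym X Y : isomorphic X Y -> isomorphic Y X.
Proof. by move=> [f [g [gf fg]]]; exists g, f. Qed.

Lemma iso_dsum2 X Y O : is_zero O -> isomorphic X Y -> is_dsum2 X Y O.
Proof.
move=> O0 [f [g [gf fg]]]; exists g, f, 0, 0.
by split; rewrite ?comp0 ?comp0l ?addr0 // ((O0 O).1 (idm O)).
Qed.

(** A decomposition writes the identity as the sum of the idempotents [i1 ⊚ p1] and [i2 ⊚ p2], so
    locality makes one of them invertible. The projection to the other summand kills it, hence is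
    0. *)
Lemma local_end_indecomposable X : local_end X -> indecomposable X.
Proof.
move=> [X1 Xloc]; split=> [X0|Y Z [i1 [p1 [i2 [p2 [e1 e2 p1i2 p2i1 eX]]]]]].
  by apply: X1; exact: (X0 X).1.
have: is_iso (i1 ⊚ p1 + i2 ⊚ p2) by rewrite eX; exists (idm X); rewrite comp1m.
case/Xloc=> -[k [_ ek]].
- right; apply: is_zero_id; rewrite -e2.
  suff -> : p2 = 0 by rewrite comp0l.
  by rewrite -(compm1 p2) -ek !compA p2i1 !comp0l.
- left; apply: is_zero_id; rewrite -e1.
  suff -> : p1 = 0 by rewrite comp0l.
  by rewrite -(compm1 p1) -ek !compA p1i2 !comp0l.
Qed.

Lemma hom_iso_eq0 X X' Y Y' : isomorphic X X' -> isomorphic Y Y' ->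
  (forall f : Defs.hom X Y, f = 0) -> forall f : Defs.hom X' Y', f = 0.
Proof.
move=> [u [u' [_ uu']]] [v [v' [_ vv']]] XY0 f.
by rewrite -(compm1 f) -uu' -(comp1m f) -vv' -!compA [f ⊚ (u ⊚ _)]compA
           [v' ⊚ _]compA [v' ⊚ _]XY0 comp0l comp0.
Qed.

Lemma subcategory_iso (S : C -> Prop) X Y O : is_zero O -> subcategory S ->
  isomorphic X Y -> S X -> S Y.
Proof.
by move=> O0 [_ _ sumS] XY; apply: sumS; exact: iso_dsum2 O0 XY.
Qed.

End LinearCategory.

(** * Triangles, retracts and orthogonality *)

Section Triangulated.
Local Open Scope ring_scope.
Context {K : fieldType} {C : triangulated_category K}.
Implicit Types X Y Z T : C.

Lemma sh_zero (O : C) : is_zero O -> is_zero (sh O).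
Proof.
by move=> O0; apply: is_zero_id; rewrite -shm1 ((O0 O).1 (idm O)) linear0.
Qed.

Section Triangle.
Context {X Y Z : C} {f : Defs.hom X Y} {g : Defs.hom Y Z} {h : Defs.hom Z (sh X)}.
Hypothesis tri : triangle f g h.

(** Extending [idm X] and [f] to a morphism from the triangle on [idm X] makes [g ⊚ f] factor
    through a zero object. *)
Lemma triangle_comp0 : g ⊚ f = 0.
Proof.
have [O O0] := zero_ex C.
have [|w []] := @triangle_mor _ C _ _ _ _ _ _ _ _ _ _ _ _ (idm X) f
  (triangle_id X O0) tri; first by [].
by rewrite comp0.
Qed.

(** The factorization is the third component of a morphism to the triangle on [0 -> T = T]. *)
Lemma triangle_weak_coker T (k : Defs.hom Y T) : k ⊚ f = 0 ->
  exists k' : Defs.hom Z T, k = k' ⊚ g.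
Proof.
move=> kf0; have [O O0] := zero_ex C.
have tri' : triangle (0 : Defs.hom O T) (idm T) (0 : Defs.hom T (sh O)).
  by apply/triangle_rot; rewrite linear0 oppr0; exact/triangle_id/sh_zero.
have [|w [e _]] := @triangle_mor _ C _ _ _ _ _ _ _ _ _ _ _ _ (0 : Defs.hom X O) k
  tri tri'; first by rewrite kf0 comp0.
by exists w; rewrite e comp1m.
Qed.

(** The axiom [triangle_mor] supplies only the third component. So both triangles are rotated once,
    and the resulting map between suspensions is desuspended by full faithfulness of [sh]. *)
Lemma triangle_weak_ker T (k : Defs.hom T Y) : g ⊚ k = 0 ->
  exists k' : Defs.hom T X, k = f ⊚ k'.
Proof.
move=> gk0; have [O O0] := zero_ex C.
have /triangle_rot tri1 := triangle_id T O0.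
have /triangle_rot tri2 := tri.
have [|w [_ e]] := @triangle_mor _ C _ _ _ _ _ _ _ _ _ _ _ _ k (0 : Defs.hom O Z)
  tri1 tri2; first by rewrite gk0 comp0l.
have [s sK Ks] := @shm_bij _ C T X.
exists (s w); apply: (bij_inj (@shm_bij _ C T Y)).
rewrite shmM Ks; apply: oppr_inj.
by move: e; rewrite compNl compN shm1 compm1.
Qed.

End Triangle.

Lemma triangle_split X Y Z (f : Defs.hom X Y) (g : Defs.hom Y Z)
    (h : Defs.hom Z (sh X)) (r : Defs.hom Y X) :
  triangle f g h -> r ⊚ f = idm X -> is_dsum2 Y X Z.
Proof.
move=> tri rf; have /triangle_rot tri1 := tri.
have /triangle_rot tri2 := tri1.
(* The map [shm f] is a split monomorphism, and up to sign its composite with [h] is a composite of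
   consecutive maps in a rotated triangle. *)
have h0 : h = 0.
  apply/oppr_inj; rewrite oppr0 -(comp1m (- h)) -shm1 -rf shmM compN -compA -compN.
  by rewrite -compNl (triangle_comp0 tri2) comp0.
have [|s0 gs0] := triangle_weak_ker tri1 (k := idm Z); first by rewrite h0 comp0l.
have gf0 := triangle_comp0 tri.
(* The section [s0] of [g] is corrected so that [r] kills it. *)
pose s := s0 - f ⊚ r ⊚ s0.
have gs : g ⊚ s = idm Z by rewrite compD -gs0 compN !compA gf0 !comp0l oppr0 addr0.
have rs : r ⊚ s = 0 by rewrite compD compN !compA rf comp1m addrN.
exists f, r, s, g; split=> //.
(* The error term [e] is killed by [g], so it factors through [f]; it is also killed by [r], a left
   inverse of [f]. *)
apply/eqP; rewrite -subr_eq0; apply/eqP; set e := _ - _.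
have ge : g ⊚ e = 0.
  by rewrite compD compN compm1 compD !compA gf0 gs comp0l comp1m add0r addrN.
have [e' ee] := triangle_weak_ker tri ge.
have re : r ⊚ e = 0.
  by rewrite compD compN compm1 compD !compA rf rs comp0l comp1m addr0 addrN.
by rewrite ee -(comp1m e') -rf -[r ⊚ f ⊚ e']compA -ee re comp0.
Qed.

(** Closure under summands asks for a complement of [X] in [Y]; the cone of [s] is one. *)
Lemma subcategory_retract (S : C -> Prop) X Y (s : Defs.hom X Y)
    (r : Defs.hom Y X) : subcategory S -> r ⊚ s = idm X -> S Y -> S X.
Proof.
move=> [_ _ sumS] rs; have [Z [g [h tri]]] := triangle_ex s.
exact/sumS/(triangle_split tri rs).
Qed.

(** Instead of building iterated biproducts isomorphic to [W], the induction factors the sum of the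
    [inj i ⊚ prj i] through an object of [S]. That sum is the identity, so [W] is a retract of this
    object. *)
Lemma subcategory_dsum (S : C -> Prop) m (U : 'I_m -> C) W :
  subcategory S -> is_dsum W U -> (forall i, S (U i)) -> S W.
Proof.
move=> Ssub [inj [prj [_ _ eW]]] SU; have [S0 SD _] := Ssub.
suff [V [r [s [SV rs]]]] : exists (V : C) (r : Defs.hom V W) (s : Defs.hom W V),
    S V /\ r ⊚ s = \sum_i inj i ⊚ prj i.
  by apply: (subcategory_retract (s := s) (r := r)) SV => //; rewrite rs eW.
elim: m U inj prj SU {eW} => [|m IH] U inj prj SU.
  have [O O0] := zero_ex C; exists O, 0, 0; split; first exact: S0.
  by rewrite big_ord0 comp0.
have [V [r [s [SV rs]]]] := IH _ (fun i => inj (lift ord0 i))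
  (fun i => prj (lift ord0 i)) (fun i => SU (lift ord0 i)).
have [V' VV'] := dsum2_ex (U ord0) V.
have [i1 [p1 [i2 [p2 [e1 e2 p1i2 p2i1 _]]]]] := VV'.
exists V', (inj ord0 ⊚ p1 + r ⊚ p2), (i1 ⊚ prj ord0 + i2 ⊚ s).
split; first exact: SD VV' _ _.
rewrite big_ord_recl -rs !compD !compDl -!compA.
rewrite [p1 ⊚ (i1 ⊚ _)]compA [p2 ⊚ (i1 ⊚ _)]compA [p1 ⊚ (i2 ⊚ _)]compA.
by rewrite [p2 ⊚ (i2 ⊚ _)]compA e1 e2 p1i2 p2i1 !comp1m !comp0l !comp0 addr0 add0r.
Qed.

(** If the aisle has no non-zero map to [T], the first map of the triangle decomposing [T] vanishes;
    then [idm T] factors through the second, and [T] is a retract of an object of [Y]. *)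
Lemma coaisle_orthogonal (X Y : C -> Prop) : torsion_pair X Y -> forall T : C,
  Y T <-> forall S, X S -> forall f : Defs.hom S T, f = 0.
Proof.
move=> [Xsub Ysub XY0 dec] T; split=> [YT S XS f|T0].
  exact: (XY0 S T XS YT f).
have [S [U [f [g [h [XS YU tri]]]]]] := dec T.
have [|r rg] := triangle_weak_coker tri (k := idm T).
  by rewrite comp1m; exact: T0.
exact: subcategory_retract Ysub (esym rg) YU.
Qed.

(** By minimality of [add_arcs], this lets orthogonality to an aisle be tested on its generating
    arcs. *)
Lemma orthogonal_subcategory T :
  subcategory (fun S : C => forall f : Defs.hom S T, f = 0).
Proof.
split=> [S S0 f|W S S' [i1 [p1 [i2 [p2 [_ _ _ _ eW]]]]] S0 S'0 f|].
- exact: (S0 T).1.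
- by rewrite -(compm1 f) -eW compD !compA [f ⊚ i1]S0 [f ⊚ i2]S'0 !comp0l addr0.
- move=> W S S' [i1 [p1 [i2 [p2 [e1 _ _ _ _]]]]] W0 f.
  by rewrite -(compm1 f) -e1 compA [f ⊚ p1]W0 comp0l.
Qed.

End Triangulated.

(** * The Kreweras complement *)

Section Kreweras.
Context {n : nat} (P : {set {set 'I_n}}).
Hypothesis hP : noncrossing P.
Implicit Types (i j k l b c : 'I_n) (A B : {set 'I_n}) (Q : {set {set 'I_n.*2}}).

(* The chord from i' to j' has all elements of each block of P on one side. *)
Definition unseparated i j : bool :=
  [forall B in P, forall b in B, forall c in B,
     (b <= i)%N (+) (c <= i)%N == (b <= j)%N (+) (c <= j)%N].

Lemma unseparatedP i j :
  reflect (forall B b c, B \in P -> b \in B -> c \in B ->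
             (b <= i)%N (+) (c <= i)%N = (b <= j)%N (+) (c <= j)%N)
          (unseparated i j).
Proof.
apply: (iffP forall_inP) => [h B b c /h/forall_inP hB /hB/forall_inP hb /hb/eqP//|h B BP].
by apply/forall_inP => b bB; apply/forall_inP => c cB; rewrite (h B).
Qed.

Lemma unseparated_refl : reflexive unseparated.
Proof. by move=> i; apply/unseparatedP. Qed.

Lemma unseparated_sym : symmetric unseparated.
Proof.
by move=> i j; apply/unseparatedP/unseparatedP => h B b c BP bB cB; rewrite (h B).
Qed.

Lemma unseparated_trans : transitive unseparated.
Proof.
move=> j i k /unseparatedP ij /unseparatedP jk; apply/unseparatedP => B b c BP bB cB.
by rewrite (ij B) // (jk B).
Qed.

(** Two crossing chords cut the circle into four parts, any two of which are separated by one of the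
    chords. So each block lies in a single part. *)
Lemma unseparated_crossing i j k l : (i < k)%N -> (k < j)%N -> (j < l)%N ->
  unseparated i j -> unseparated k l -> unseparated i k.
Proof.
move=> ik kj jl /unseparatedP ij /unseparatedP kl; apply/unseparatedP => B b c BP bB cB.
have := ij B b c BP bB cB; have := kl B b c BP bB cB.
by case: (leqP b i); case: (leqP c i); case: (leqP b k); case: (leqP c k);
   case: (leqP b j); case: (leqP c j); case: (leqP b l); case: (leqP c l) => //=; lia.
Qed.

Lemma half_subproof (p : 'I_n.*2) : (p./2 < n)%N.
Proof. by rewrite ltn_half_double. Qed.

Definition half_ord (p : 'I_n.*2) : 'I_n := Ordinal (half_subproof p).

Lemma half_unprimed i : half_ord (unprimed i) = i.
Proof. by apply/val_inj; rewrite /= doubleK. Qed.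

Lemma half_primed i : half_ord (primed i) = i.
Proof. by apply/val_inj; rewrite /= uphalf_double. Qed.

Lemma primed_notin_unprimed i A : primed i \notin [set unprimed j | j in A].
Proof.
apply/negP => /imsetP[k _ /(congr1 (fun p : 'I_n.*2 => odd p))] /=.
by rewrite !odd_double.
Qed.

(** The classes of this relation are an explicit candidate for the coarsest extension; even
    positions are unprimed, odd ones primed. *)
Definition kreweras_rel (p q : 'I_n.*2) : bool :=
  (odd p == odd q) &&
  (if odd p then unseparated (half_ord p) (half_ord q)
   else finset.pblock P (half_ord p) == finset.pblock P (half_ord q)).

Definition kreweras_extension := equivalence_partition kreweras_rel [set: 'I_n.*2].

Lemma kreweras_rel_equiv :
  {in [set: 'I_n.*2] & &, equivalence_rel kreweras_rel}.
Proof.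
move=> p q r _ _ _; rewrite /kreweras_rel eqxx /=; split.
  by case: ifP; rewrite ?unseparated_refl.
case: (odd p); case: (odd q) => //= pq; last by rewrite (eqP pq).
case: (odd r) => //=; apply/idP/idP; apply: unseparated_trans => //.
by rewrite unseparated_sym.
Qed.

Lemma kreweras_extension_partition :
  finset.partition kreweras_extension [set: 'I_n.*2].
Proof. exact: equivalence_partitionP kreweras_rel_equiv. Qed.

Lemma kreweras_extensionP (B : {set 'I_n.*2}) p q : B \in kreweras_extension -> p \in B ->
  (q \in B) = kreweras_rel p q.
Proof.
move=> BQ pB; rewrite -(pblock_equivalence_partition kreweras_rel_equiv) ?inE //.
have [_ tQ _] := and3P kreweras_extension_partition.
by rewrite (def_pblock tQ BQ pB).
Qed.

Lemma partition_pblock_eq B i j : B \in P -> i \in B ->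
  (j \in B) = (finset.pblock P i == finset.pblock P j).
Proof.
have [/and3P[/eqP cP tP _] _] := andP hP => BP iB.
by rewrite eq_pblock ?cP ?inE // (def_pblock tP BP iB).
Qed.

Lemma pblock_mem_noncrossing i : finset.pblock P i \in P /\ i \in finset.pblock P i.
Proof.
have [/and3P[/eqP cP _ _] _] := andP hP.
by rewrite mem_pblock pblock_mem cP inE.
Qed.

Lemma pblock_crossing i j k l : (i < k)%N -> (k < j)%N -> (j < l)%N ->
  finset.pblock P i = finset.pblock P j -> finset.pblock P k = finset.pblock P l ->
  finset.pblock P i = finset.pblock P k.
Proof.
have [_ /forall_inP nc] := andP hP => ik kj jl ij kl.
have [iP ii] := pblock_mem_noncrossing i; have [kP kk] := pblock_mem_noncrossing k.
move: (nc _ iP) => /forall_inP/(_ _ kP)/forall_inP/(_ i ii)/forall_inP/(_ j).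
rewrite ij (proj2 (pblock_mem_noncrossing j)) => /(_ isT)/forall_inP/(_ k kk)/forall_inP/(_ l).
by rewrite kl (proj2 (pblock_mem_noncrossing l)) ik kj jl => /(_ isT)/eqP.
Qed.

Lemma kreweras_extension_noncrossing : noncrossing kreweras_extension.
Proof.
rewrite /noncrossing kreweras_extension_partition /=.
apply/forall_inP => B1 B1Q; apply/forall_inP => B2 B2Q.
apply/forall_inP => p pB; apply/forall_inP => q qB.
apply/forall_inP => r rB; apply/forall_inP => s sB.
apply/implyP => /and3P[pr rq qs].
suff rB1: r \in B1.
  have [_ tQ _] := and3P kreweras_extension_partition.
  by rewrite -(def_pblock tQ B1Q rB1) (def_pblock tQ B2Q rB).
have := qB; have := sB; rewrite (kreweras_extensionP _ B2Q rB) !(kreweras_extensionP _ B1Q pB).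
rewrite /kreweras_rel.
(* Splitting each position into parity and half leaves four cases. When the parities of the two
   blocks differ, a block of [P] would have elements on both sides of a chord that does not separate
   it. *)
have hE (t : 'I_n.*2) : (t : nat) = (odd t + (half_ord t).*2)%N by rewrite /= odd_double_half.
move: (hE p) (hE q) (hE r) (hE s).
move: (half_ord p) (half_ord q) (half_ord r) (half_ord s) => p' q' r' s'.
move: (odd p) (odd q) (odd r) (odd s) => op oq or os.
case: or os => -[]; case: op oq => -[] //= hp hq hr hs.
- move=> rs' pq'; apply: (unseparated_crossing _ _ _ pq' rs');
    clear -pr rq qs hp hq hr hs; lia.
- move=> /unseparatedP rs' pq'.
  have [pP pp] := pblock_mem_noncrossing p'.
  have := rs' _ p' q' pP pp; rewrite (partition_pblock_eq _ pP pp) pq'.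
  by move/(_ isT); do 4!case: leqP => //=; clear -pr rq qs hp hq hr hs; lia.
- move=> rs' /unseparatedP pq'.
  have [rP rr] := pblock_mem_noncrossing r'.
  have := pq' _ r' s' rP rr; rewrite (partition_pblock_eq _ rP rr) rs'.
  by move/(_ isT); do 4!case: leqP => //=; clear -pr rq qs hp hq hr hs; lia.
- move=> /eqP rs' /eqP pq'; apply/eqP; apply: (pblock_crossing _ _ _ pq' rs');
    clear -pr rq qs hp hq hr hs; lia.
Qed.

Lemma kreweras_extension_extends : extends_blocks P kreweras_extension.
Proof.
rewrite /extends_blocks kreweras_extension_noncrossing /=.
apply/subsetP => _ /imsetP[B BP ->].
have [/and3P[_ _ P0] _] := andP hP.
have [b bB] : exists b, b \in B.
  by apply/set0Pn; apply: contraNneq P0 => <-.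
have [/eqP cQ tQ _] := and3P kreweras_extension_partition.
suff -> : [set unprimed i | i in B] = finset.pblock kreweras_extension (unprimed b).
  by rewrite pblock_mem // cQ inE.
apply/setP => p; rewrite (pblock_equivalence_partition kreweras_rel_equiv) ?inE //.
rewrite /kreweras_rel half_unprimed /= odd_double /= -(partition_pblock_eq _ BP bB).
apply/imsetP/andP => [[i iB ->]|[ep pB]]; first by rewrite half_unprimed /= odd_double.
exists (half_ord p) => //; apply/val_inj => /=.
by rewrite -[LHS]odd_double_half; case: (odd _) ep.
Qed.

(** A block of [P] split by the chord from [i'] to [j'] would cross [B], hence equal [B] as a block
    of [Q]; but [B] has a primed element. As [b] precedes [i'] exactly when [b <= i], the split
    blocks are those excluded by [unseparated]. *)
Lemma extends_unseparated Q (B : {set 'I_n.*2}) i j : extends_blocks P Q -> B \in Q ->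
  primed i \in B -> primed j \in B -> unseparated i j.
Proof.
move=> /andP[/andP[Qpart /forall_inP nc] /fintype.subsetP PQ] BQ iB jB.
(* [crossF] treats the crossings whose first point is unprimed, and [crossF'] those whose first
   point is primed; swapping [b], [c] and [i], [j] gives all cases. *)
have crossF (b c i' j' : 'I_n) A : A \in P -> b \in A -> c \in A ->
    primed i' \in B -> primed j' \in B ->
    (b <= i')%N -> (i' < c)%N -> (c <= j')%N -> False.
  move=> AP bA cA iB' jB' bi ic cj.
  have UQ : [set unprimed i | i in A] \in Q by apply/PQ/imsetP; exists A.
  move: (nc _ UQ) => /forall_inP/(_ _ BQ)/forall_inP/(_ (unprimed b) (imset_f _ bA)).
  move/forall_inP/(_ (unprimed c) (imset_f _ cA))/forall_inP/(_ _ iB').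
  move/forall_inP/(_ _ jB')/implyP => H.
  have /eqP AB := H ltac:(clear -bi ic cj; rewrite /=; lia).
  by move: iB'; rewrite -AB (negPf (primed_notin_unprimed _ _)).
have crossF' (b c i' j' : 'I_n) A : A \in P -> b \in A -> c \in A ->
    primed i' \in B -> primed j' \in B ->
    (i' < b)%N -> (b <= j')%N -> (j' < c)%N -> False.
  move=> AP bA cA iB' jB' bi ic cj.
  have UQ : [set unprimed i | i in A] \in Q by apply/PQ/imsetP; exists A.
  move: (nc _ BQ) => /forall_inP/(_ _ UQ)/forall_inP/(_ _ iB')/forall_inP/(_ _ jB').
  move/forall_inP/(_ (unprimed b) (imset_f _ bA))/forall_inP/(_ (unprimed c) (imset_f _ cA)).
  move/implyP => H; have /eqP AB := H ltac:(clear -bi ic cj; rewrite /=; lia).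
  by move: iB'; rewrite AB (negPf (primed_notin_unprimed _ _)).
apply/unseparatedP => A b c AP bA cA.
have h1 := crossF b c i j A AP bA cA iB jB; have h2 := crossF c b i j A AP cA bA iB jB.
have h3 := crossF b c j i A AP bA cA jB iB; have h4 := crossF c b j i A AP cA bA jB iB.
have g1 := crossF' b c i j A AP bA cA iB jB; have g2 := crossF' c b i j A AP cA bA iB jB.
have g3 := crossF' b c j i A AP bA cA jB iB; have g4 := crossF' c b j i A AP cA bA jB iB.
by case: (leqP b i) => ?; case: (leqP c i) => ?; case: (leqP b j) => ?;
   case: (leqP c j) => ? //=; exfalso;
   do [by apply: h1 | by apply: h2 | by apply: h3 | by apply: h4
      | by apply: g1 | by apply: g2 | by apply: g3 | by apply: g4].
Qed.

Lemma kreweras_extension_coarsest : coarsest_extension P kreweras_extension.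
Proof.
rewrite /coarsest_extension kreweras_extension_extends.
apply/forallP => Q; apply/implyP => QP; apply/forall_inP => B BQ.
have [/andP[/and3P[_ tQ Q0] _] /fintype.subsetP PQ] := andP QP.
have [p pB] : exists p, p \in B.
  by apply/set0Pn; apply: contraNneq Q0 => <-.
have [/eqP cE _ _] := and3P kreweras_extension_partition.
have pE : finset.pblock kreweras_extension p \in kreweras_extension.
  by rewrite pblock_mem // cE inE.
apply/exists_inP; exists (finset.pblock kreweras_extension p) => //.
apply/fintype.subsetP => q qB; rewrite (kreweras_extensionP (p := p) _ pE); last first.
  by rewrite mem_pblock cE inE.
(* Blocks of [Q] are disjoint, so one with an unprimed element is the image of a block of [P]. *)
have unprimedB r s : r \in B -> s \in B -> ~~ odd r ->
    ~~ odd s /\ finset.pblock P (half_ord r) = finset.pblock P (half_ord s).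
  move=> rB sB er; have [hrP hr] := pblock_mem_noncrossing (half_ord r).
  have rA : r \in [set unprimed i | i in finset.pblock P (half_ord r)].
    apply/imsetP; exists (half_ord r) => //; apply/val_inj => /=.
    by rewrite -[LHS]odd_double_half (negPf er).
  have AQ : [set unprimed i | i in finset.pblock P (half_ord r)] \in Q.
    by apply/PQ/imsetP; exists (finset.pblock P (half_ord r)).
  move: sB; rewrite -(def_pblock tQ BQ rB) (def_pblock tQ AQ rA) => /imsetP[i iA ->].
  rewrite half_unprimed /= odd_double; split=> //.
  by apply/eqP; rewrite -(partition_pblock_eq _ hrP hr).
rewrite /kreweras_rel; case: ifPn => [op|/(unprimedB _ _ pB qB)[/negPf-> ->]//]; last first.
  by rewrite !eqxx.
have [oq|/(unprimedB _ _ qB pB)[]] := boolP (odd q); last by rewrite op.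
have oddE (r : 'I_n.*2) : odd r -> r = primed (half_ord r).
  by move=> or; apply/val_inj; rewrite /= -[LHS]odd_double_half or.
by rewrite eqxx (extends_unseparated QP BQ) // -oddE.
Qed.

(** The partition picked by [kreweras] need not be identified with [kreweras_extension]: being an
    extension gives one direction, and being refined by [kreweras_extension] gives the other. *)
Lemma krewerasP i j :
  (exists2 B, B \in kreweras P & (i \in B) && (j \in B)) <-> unseparated i j.
Proof.
(* The default value of [kreweras] is excluded by the explicit coarsest extension. *)
rewrite /kreweras; case: pickP => [Q /andP[QP /forallP Qmax]|]; last first.
  by move/(_ kreweras_extension); rewrite kreweras_extension_coarsest.
split=> [[_ /imsetP[B /setDP[BQ _] ->]]|ij].
  by rewrite !inE => /andP[]; exact: extends_unseparated BQ.
have := implyP (Qmax _) kreweras_extension_extends.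
have [/eqP cE _ _] := and3P kreweras_extension_partition.
have pE : finset.pblock kreweras_extension (primed i) \in kreweras_extension.
  by rewrite pblock_mem // cE inE.
have iE : primed i \in finset.pblock kreweras_extension (primed i).
  by rewrite mem_pblock cE inE.
move=> /forall_inP/(_ _ pE)/exists_inP[B BQ /fintype.subsetP EB].
have iB := EB _ iE.
have jB : primed j \in B.
  apply: EB; rewrite (kreweras_extensionP _ pE iE) /kreweras_rel /= !odd_double /=.
  by rewrite !half_primed.
exists [set k | primed k \in B]; last by rewrite !inE iB.
apply/imsetP; exists B => //; rewrite inE BQ andbT.
by apply/negP => /imsetP[A _ BA]; move: iB; rewrite BA (negPf (primed_notin_unprimed _ _)).
Qed.

End Kreweras.

From mathcomp Require Import all_classical all_reals all_analysis.
Import numFieldNormedType.Exports.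
Local Open Scope classical_set_scope.
Local Open Scope ring_scope.

(** * The circle in angular coordinates *)

Section Angles.
Context {R : realType}.
Implicit Types (s t u v w : R) (p q r : R * R).
Local Notation tau := (2 * pi : R).

Lemma cisD s t u : cis s = cis t -> cis (s + u) = cis (t + u).
Proof. by move=> [es et]; rewrite /cis !cosD !sinD es et. Qed.

Lemma cisDtau t : cis (t + tau) = cis t.
Proof. by rewrite /cis mulr_natl cosD2pi sinD2pi. Qed.

Lemma cisBtau t : cis (t - tau) = cis t.
Proof. by rewrite -[RHS](cisDtau) -[in RHS](subrK tau t) cisDtau cisDtau. Qed.

(** The cosine of [s - t] is 1, so the sine of half the difference vanishes, and this half lies
    strictly between [- pi] and [pi]. *)
Lemma cis_inj s t : cis s = cis t -> `|s - t| < tau -> s = t.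
Proof.
move=> [es et] st.
have : cos (s - t) = 1 by rewrite cosB es et -!expr2 cos2Dsin2.
rewrite (_ : s - t = ((s - t) / 2) *+ 2); last by rewrite -mulr_natr divfK.
rewrite cos_mulr2n cos2sin2 => /eqP; set h := (s - t) / 2.
have hpi : `|h| < pi by rewrite normrM (ger0_norm (x := 2^-1)) //; lra.
have sin_neq0 v : 0 < v < pi -> sin v ^+ 2 != 0.
  by move=> /sin_gt0_pi v0; rewrite sqrf_eq0 gt_eqF.
move=> e; have {e} /eqP e : sin h ^+ 2 = 0 by move/eqP: e; lra.
move: hpi; rewrite ltr_norml => /andP[h1 h2].
have [h0|h0|h0] := ltgtP h 0.
- have /sin_neq0 : 0 < - h < pi by lra.
  by rewrite sinN sqrrN e.
- have /sin_neq0 : 0 < h < pi by lra.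
  by rewrite e.
- by move: h0; rewrite /h; lra.
Qed.

Lemma circle_cis p : circle p -> exists2 t, - pi <= t <= pi & p = cis t.
Proof.
case: p => x y; rewrite /circle /= => xy.
have x1 : -1 <= x <= 1.
  by rewrite -ler_norml -(@ler_pXn2r _ 2) ?nnegrE // expr1n real_normK ?num_real //;
     have := sqr_ge0 y; lra.
have ey : Num.sqrt (1 - x ^+ 2) = `|y|.
  by rewrite -sqrtr_sqr; congr Num.sqrt; lra.
have cx : cos (acos x) = x by rewrite acosK // in_itv.
have a0 := acos_ge0 x1; have api := acos_lepi x1.
have [y0|y0] := leP 0 y.
  exists (acos x); first by lra.
  by rewrite /cis sin_acos // ey cx ger0_norm.
exists (- acos x); first by lra.
by rewrite /cis cosN sinN sin_acos // ey cx ltr0_norm // opprK.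
Qed.

(** The coordinate on the circle cut open at [cis t0]; the default 0 is taken only off the
    circle. *)
Definition angle (t0 : R) p : R :=
  xget 0 [set u | 0 <= u < tau /\ p = cis (t0 + u)].

Lemma angle_cis t0 u : 0 <= u < tau -> angle t0 (cis (t0 + u)) = u.
Proof.
move=> hu; rewrite /angle; case: xgetP => [v _ [hv /cis_inj]|/(_ u)[]//].
by rewrite ltr_norml => /(_ ltac:(lra)); lra.
Qed.

Lemma circle_angle t0 p : circle p -> 0 <= angle t0 p < tau /\ p = cis (t0 + angle t0 p).
Proof.
have pi0 := pi_gt0 R; move=> /circle_cis[t ht ->].
(* With [t0] replaced by [s], the difference [t - s] is at most one turn either way, so a single
   correction by [tau] suffices. *)
have [s hs es] : exists2 s, - pi <= s <= pi & cis t0 = cis s.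
  by apply: circle_cis; exact: cos2Dsin2.
suff [u hu ->] : exists2 u, 0 <= u < tau & cis t = cis (t0 + u) by rewrite angle_cis.
suff [u hu ->] : exists2 u, 0 <= u < tau & cis t = cis (s + u).
  by exists u => //; apply/esym/cisD.
have [lt_t|le_t] := ltP t s.
  exists (t - s + tau); first by lra.
  by rewrite -[LHS]cisDtau; congr cis; ring.
have [lt_tau|ge_tau] := ltP (t - s) tau.
  by exists (t - s); [lra|congr cis; ring].
exists (t - s - tau); first by lra.
by rewrite -[LHS]cisBtau; congr cis; ring.
Qed.

Definition cyclic3 u v w : bool := [|| u < v < w, v < w < u | w < u < v].

(* Both sides say that the chords pq and rs of the circle cross. *)
Lemma cyclic4P (p q r s : R) :
  ([/\ cyclic3 p r q, cyclic3 r q s, cyclic3 q s p & cyclic3 s p r]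
   \/ [/\ cyclic3 p s q, cyclic3 s q r, cyclic3 q r p & cyclic3 r p s]) <->
  [&& p != r, p != s, q != r, q != s & (p < r) (+) (p < s) != (q < r) (+) (q < s)].
Proof.
rewrite /cyclic3.
case: (ltgtP p r) => ?; case: (ltgtP p s) => ?; case: (ltgtP q r) => ?;
case: (ltgtP q s) => ?; rewrite /= ?andbF ?orbF.
all: try by split=> [[[]|[]]|] //.
all: case: (ltgtP p q) => ? //=; try by split=> [[[]|[]]|] //.
all: case: (ltgtP r s) => ? //=; try by split=> [[[]|[]]|] //.
all: try by exfalso; lra.
all: by split=> // _; (left + right).
Qed.

Lemma ccw_cis t u v : 0 <= u < tau -> 0 <= v < tau ->
  ccw (cis t) (cis (t + u)) (cis (t + v)) <-> 0 < u < v.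
Proof.
move=> hu hv; split=> [[s [u' [v' [es eu ev [u0 uv v1]]]]]|huv]; last first.
  by exists t, u, v; split=> //; split; lra.
have /cis_inj euE : cis (t + u) = cis (t + u') by rewrite eu; apply/esym/cisD.
have /cis_inj evE : cis (t + v) = cis (t + v') by rewrite ev; apply/esym/cisD.
move: euE evE; rewrite !ltr_norml => /(_ ltac:(lra)) ? /(_ ltac:(lra)) ?; lra.
Qed.

Lemma ccw_cyclic3 t u v w : 0 <= u < tau -> 0 <= v < tau -> 0 <= w < tau ->
  ccw (cis (t + u)) (cis (t + v)) (cis (t + w)) <-> cyclic3 u v w.
Proof.
move=> hu hv hw.
(* The circle is cut again at the first point, where [ccw] becomes the linear order of [ccw_cis]. *)
pose shift x := if u <= x then x - u else x - u + tau.
have shiftP x : 0 <= x < tau -> 0 <= shift x < tau /\ cis (t + x) = cis (t + u + shift x).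
  move=> hx; rewrite /shift; case: (leP u x) => ux; (split; first by lra).
    by congr cis; ring.
  by rewrite -cisDtau; congr cis; ring.
have [sv ->] := shiftP v hv; have [sw ->] := shiftP w hw.
rewrite ccw_cis // /cyclic3 /shift; case: (leP u v) => ?; case: (leP u w) => ?.
all: by split=> h; [apply/orP|case/orP: h => [|/orP[]]]; lra.
Qed.

(** The value [w = tau] is allowed because it is the right end of the last segment. *)
Lemma ccw_between t u v w : 0 <= u -> u < w -> w <= tau -> w - u < tau ->
  0 <= v < tau ->
  ccw (cis (t + u)) (cis (t + v)) (cis (t + w)) <-> u < v < w.
Proof.
have pi0 := pi_gt0 R; move=> u0 uw w1 uw1 hv; have [w2|w2] := ltP w tau.
  by rewrite ccw_cyclic3 /cyclic3; lra.
have -> : w = tau by lra.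
rewrite cisDtau -[in X in ccw _ _ X](addr0 t) ccw_cyclic3 /cyclic3; lra.
Qed.

Lemma nbhs_cis t (V : set (R * R)) : nbhs (cis t) V ->
  exists2 e : R, 0 < e & forall u, `|u - t| < e -> V (cis u).
Proof.
have cont : cis u @[u --> t] --> cis t.
  exact: (cvg_pair (@continuous_cos R t) (@continuous_sin R t)).
by move=> /cont/nbhs_ballP[e e0 h]; exists e => // u ute; apply: h; rewrite /ball /= distrC.
Qed.

End Angles.

(** * Nearest points of a locally discrete set of reals *)

Section FirstPoint.
Context {R : realType}.
Implicit Types (F : R -> Prop) (lo hi t u v m e : R).

Definition locally_discrete F lo hi := forall m, lo < m < hi ->
  exists2 e, 0 < e & forall u, 0 < `|u - m| < e -> ~ F u.

(** The infimum of the points of [F] beyond [t] lies strictly between [lo] and [hi]. If it were not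
    attained, points of [F] would accumulate there. *)
Lemma first_point F lo hi t : locally_discrete F lo hi -> lo < t ->
  (exists2 u, t < u < hi & F u) ->
  exists u, [/\ t < u < hi, F u & forall v, t < v < u -> ~ F v].
Proof.
move=> disc lot [u0 hu0 Fu0].
pose A := [set u | t < u < hi /\ F u].
have lbA : lbound A t by move=> u [/andP[/ltW]].
have infA : has_inf A by split; [exists u0|exists t].
have tm : t <= inf A by apply: lb_le_inf => //; exists u0.
have mu v : A v -> inf A <= v by apply: ge_inf; exists t.
have mu0 := mu u0 (conj hu0 Fu0).
have [|e e0 he] := disc (inf A); first by lra.
have [u [hu Fu] ue] := inf_adherent e0 infA.
exists u; split=> // v hv Fv.
have mv : inf A <= v by apply: mu; split=> //; lra.
have [um|um] := ltP (inf A) u; last by lra.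
by apply: (he u) => //; rewrite ger0_norm; lra.
Qed.

Lemma last_point F lo hi t : locally_discrete F lo hi -> t < hi ->
  (exists2 u, lo < u < t & F u) ->
  exists u, [/\ lo < u < t, F u & forall v, u < v < t -> ~ F v].
Proof.
move=> disc thi [u0 hu0 Fu0].
have [|||u [hu Fu uN]] := @first_point (F \o -%R) (- hi) (- lo) (- t).
- move=> m hm; have [|e e0 he] := disc (- m); first by lra.
  by exists e => // u hu; apply: he; rewrite -normrN opprB addrC opprK in hu *.
- by lra.
- by exists (- u0) => /=; [lra|rewrite opprK].
exists (- u); split=> //; first by lra.
by move=> v hv; have := uN (- v); rewrite /= opprK; apply; lra.
Qed.

End FirstPoint.

(** * Segments between limit points *)

Section Segments.
Context {R : realType} {n : nat}.
Implicit Types (u v e : R) (p q r z w : R * R) (i j : 'I_n).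
Local Notation tau := (2 * pi : R).

Lemma closed_circle : closed (@circle R).
Proof.
have -> : @circle R = (fun p : R * R => p.1 ^+ 2 + p.2 ^+ 2) @^-1` [set 1] by [].
apply: closed_comp => [p _|]; last exact: closed_eq.
by apply: cvgD; apply: cvgM; do [exact: cvg_fst|exact: cvg_snd].
Qed.

(* [alpha k] is the angle of [a k], measured from [a 0 = cis t0]; one further
   value [alpha n], a full turn, closes up the last segment. *)
Definition angles (a : 'I_n -> R * R) (t0 : R) (alpha : nat -> R) : Prop :=
  [/\ forall i, a i = cis (t0 + alpha i), alpha 0%N = 0, alpha n = tau &
      forall k l, (k < l <= n)%N -> alpha k < alpha l].

Lemma exists_angles a : (2 <= n)%N -> cyclically_ordered a ->
  (forall i, circle (a i)) -> exists t0 alpha, angles a t0 alpha.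
Proof.
move=> n2 [ainj acyc] acirc.
have n0 : (0 < n)%N by lia.
pose o := Ordinal n0.
have [t0 _ eo] := circle_cis (acirc o).
pose th i := angle t0 (a i).
have thP i : 0 <= th i < tau /\ a i = cis (t0 + th i).
  exact: circle_angle.
have pi0 := pi_gt0 R.
have th0 : th o = 0 by rewrite /th eo -[X in cis X]addr0 angle_cis //; lra.
have th_mono i j : (i < j)%N -> th i < th j.
  move=> ij; have [i0|i0] := posnP i.
    have -> : i = o by exact/val_inj.
    have [hj ej] := thP j; rewrite th0 lt_neqAle; apply/andP; split; last by lra.
    apply/eqP => j0; have jo : j = o by apply: ainj; rewrite ej eo -j0 addr0.
    by move: ij; rewrite jo.
  have [hi ei] := thP i; have [hj ej] := thP j.
  have := acyc o i j i0 ij.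
  by rewrite eo ei ej ccw_cis //; lra.
(* The default value matters here: it makes [alpha n] a full turn. *)
pose alpha k := if insub k : option 'I_n is Some i then th i else tau.
have alphaE i : alpha i = th i by rewrite /alpha valK.
have alphan : alpha n = tau by rewrite /alpha insubF // ltnn.
exists t0, alpha; split=> // [i||k l /andP[kl ln]].
- by rewrite alphaE; have [] := thP i.
- by rewrite (alphaE o).
- have kn : (k < n)%N by lia.
  rewrite (alphaE (Ordinal kn)); move: ln; rewrite leq_eqVlt => /orP[/eqP->|ln].
    by rewrite alphan; have [] := thP (Ordinal kn); lra.
  by rewrite (alphaE (Ordinal ln)); exact: th_mono.
Qed.

Context {Z : set (R * R)} {a : 'I_n -> R * R} {t0 : R} {alpha : nat -> R}.
Hypotheses (hZ : admissible Z) (haZ : range a = limit_points Z).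
Hypotheses (n2 : (2 <= n)%N) (ha : angles a t0 alpha).
Local Notation th := (angle t0).

Definition in_segment i p := alpha i < th p < alpha i.+1.

Lemma alpha_lt k l : (k < l <= n)%N -> alpha k < alpha l.
Proof. by have [_ _ _] := ha; apply. Qed.

Lemma alpha_le k l : (k <= l <= n)%N -> alpha k <= alpha l.
Proof.
by case/andP; rewrite leq_eqVlt => /orP[/eqP-> //|kl ln]; apply/ltW/alpha_lt/andP.
Qed.

Lemma alpha_range k : (k <= n)%N -> 0 <= alpha k <= tau.
Proof.
have [_ <- <- _] := ha => kn.
by rewrite !alpha_le // ?kn ?leqnn.
Qed.

Lemma alpha_ord i : alpha i < alpha i.+1 /\ 0 <= alpha i < tau.
Proof.
have [_ _ <- _] := ha; rewrite !alpha_lt ?ltnSn ?ltn_ord ?leqnn //.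
by have /andP[->] := alpha_range (ltnW (ltn_ord i)).
Qed.

(** With at least two limit points no segment is the whole circle, so [ccw_between] applies to its
    ends. *)
Lemma alpha_width i : alpha i.+1 - alpha i < tau.
Proof.
have [_ a0 an _] := ha.
have [i0|i0] := posnP i.
  have := @alpha_lt i.+1 n; rewrite i0 a0 an subr0; apply.
  by rewrite leqnn n2.
have := @alpha_lt 0 i; rewrite a0 i0 (ltnW (ltn_ord i)) => /(_ isT).
by have := alpha_range (ltn_ord i); lra.
Qed.

Lemma aSE i : a (ordS i) = cis (t0 + alpha i.+1).
Proof.
have [aE a0 an _] := ha; rewrite aE /=.
have := ltn_ord i; rewrite leq_eqVlt => /orP[/eqP e|lt_in]; last by rewrite modn_small.
by rewrite e modnn a0 an addr0 cisDtau.
Qed.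

Lemma angle_a i : th (a i) = alpha i.
Proof. by have [aE _ _ _] := ha; rewrite aE angle_cis //; have [] := alpha_ord i. Qed.

Lemma angle_inj p q : circle p -> circle q -> th p = th q -> p = q.
Proof. by move=> /(circle_angle t0)[_ ep] /(circle_angle t0)[_ eq] e; rewrite ep eq e. Qed.

Lemma Z_circle z : Z z -> circle z.
Proof. by have [h _ _ _ _] := hZ; exact: h. Qed.

Lemma angleZ z : Z z -> 0 <= th z < tau /\ z = cis (t0 + th z).
Proof. by move/Z_circle/(circle_angle t0). Qed.

Lemma ccwZ p q r : circle p -> circle q -> circle r ->
  ccw p q r = is_true (cyclic3 (th p) (th q) (th r)).
Proof.
move=> /(circle_angle t0)[hp ep] /(circle_angle t0)[hq eq] /(circle_angle t0)[hr er].
by apply/propext; rewrite {1}ep {1}eq {1}er ccw_cyclic3.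
Qed.

Lemma not_Z_a i : ~ Z (a i).
Proof. by have [] : limit_points Z (a i) by rewrite -haZ; exists i. Qed.

Lemma Z_in_segment z : Z z -> exists i, in_segment i z.
Proof.
move=> Zz; have [hz ez] := angleZ Zz.
have n0 : (0 < n)%N by lia.
have [aE a0 an _] := ha.
have thN i : alpha i <> th z.
  by move=> e; apply: (@not_Z_a i); rewrite aE e -ez.
have P0 : alpha (Ordinal n0) < th z.
  by rewrite lt_neqAle /= a0; have := thN (Ordinal n0); rewrite /= a0 => /eqP->; lra.
(* The segment is given by the last limit point before [z]. *)
case: (@arg_maxnP _ (Ordinal n0) (fun i => alpha i < th z) (fun i => i : nat) P0) => i iz imax.
exists i; rewrite /in_segment iz /=.
have := ltn_ord i; rewrite leq_eqVlt => /orP[/eqP->|Si]; first by rewrite an; lra.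
have := thN (Ordinal Si) => /= /eqP; case: ltgtP => // /(imax (Ordinal Si)) /=.
by rewrite ltnn.
Qed.

Lemma in_segment_uniq i j p : in_segment i p -> in_segment j p -> i = j.
Proof.
move=> hi hj; apply/val_inj; have [ij|ij|//] := ltngtP i j.
- have := @alpha_le i.+1 j; rewrite ij (ltnW (ltn_ord j)) => /(_ isT) ?.
  by exfalso; move: hi hj; rewrite /in_segment; lra.
- have := @alpha_le j.+1 i; rewrite ij (ltnW (ltn_ord i)) => /(_ isT) ?.
  by exfalso; move: hi hj; rewrite /in_segment; lra.
Qed.

Lemma in_segment_lt i j p q : in_segment i p -> in_segment j q -> (i < j)%N ->
  th p < th q.
Proof.
move=> hi hj ij; have := @alpha_le i.+1 j; rewrite ij (ltnW (ltn_ord j)) => /(_ isT).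
by move: hi hj; rewrite /in_segment; lra.
Qed.

Lemma cis_in_segment i u : alpha i < u < alpha i.+1 -> in_segment i (cis (t0 + u)).
Proof.
move=> hu; rewrite /in_segment angle_cis //.
by have := alpha_ord i; have := alpha_range (ltn_ord i); lra.
Qed.

Lemma two_sided_a i : two_sided Z (a i).
Proof. by have [_ _ _ _ h] := hZ; apply: h; rewrite -haZ; exists i. Qed.

Lemma Z_near_left i u : alpha i < u -> exists z, [/\ Z z, in_segment i z & th z < u].
Proof.
move=> iu; have [aE _ _ _] := ha; have [iS hi] := alpha_ord i.
pose m := Num.min u (alpha i.+1).
have [] := two_sided_a (aE i) (e := m - alpha i); first by rewrite subr_gt0 lt_min iu.
move=> [v hv Zv] _; have mu : m <= u by rewrite ge_min lexx.
have mS : m <= alpha i.+1 by rewrite ge_min lexx orbT.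
rewrite -addrA in Zv; have iv : alpha i < alpha i + v < alpha i.+1 by lra.
exists (cis (t0 + (alpha i + v))); split=> //; first exact: cis_in_segment.
by rewrite angle_cis; have := alpha_range (ltn_ord i); lra.
Qed.

Lemma Z_near_right i u : u < alpha i.+1 -> exists z, [/\ Z z, in_segment i z & u < th z].
Proof.
move=> iu; have [iS hi] := alpha_ord i.
pose m := Num.max u (alpha i).
have [] := two_sided_a (aSE i) (e := alpha i.+1 - m); first by rewrite subr_gt0 gt_max iu.
move=> _ [v hv Zv]; have mu : u <= m by rewrite le_max lexx.
have mS : alpha i <= m by rewrite le_max lexx orbT.
rewrite -addrA in Zv; have iv : alpha i < alpha i.+1 - v < alpha i.+1 by lra.
exists (cis (t0 + (alpha i.+1 - v))); split=> //; first exact: cis_in_segment.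
by rewrite angle_cis; have := alpha_range (ltn_ord i); lra.
Qed.

(** An accumulation point of [Z] is either a point of [Z], contradicting isolation, or a limit
    point, whose angle is some [alpha j] and so not inside a segment. *)
Lemma Z_locally_discrete i :
  locally_discrete (fun u => Z (cis (t0 + u))) (alpha i) (alpha i.+1).
Proof.
move=> m hm; apply: contrapT => nex.
have acc e : 0 < e -> exists u, 0 < `|u - m| < e /\ Z (cis (t0 + u)).
  move=> e0; apply: contrapT => nu; apply: nex; exists e => // u hu Zu.
  by apply: nu; exists u.
have near V : nbhs (cis (t0 + m)) V ->
    exists u, [/\ 0 < `|u - m| < tau, Z (cis (t0 + u)) & V (cis (t0 + u))].
  move=> /nbhs_cis[e e0 eV].
  (* Staying within one turn of [m] keeps the new point distinct from [cis (t0 + m)]. *)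
  have [|u [hu Zu]] := acc (Num.min e tau); first by rewrite lt_min e0; have := pi_gt0 R; lra.
  move: hu; rewrite lt_min => /and3P[u0 ue ut].
  exists u; split=> //; first by rewrite u0.
  by apply: eV; rewrite [X in `|X|](_ : _ = u - m) //; ring.
have clm : closure Z (cis (t0 + m)).
  by move=> V /near[u [_ Zu Vu]]; exists (cis (t0 + u)).
have [Zm|nZm] := pselect (Z (cis (t0 + m))).
  have [_ iso _ _ _] := hZ; have [_ [V nV VZ]] := iso _ Zm.
  have [u [hu Zu Vu]] := near V nV.
  have : (V `&` Z) (cis (t0 + u)) by [].
  rewrite VZ => /cis_inj e.
  have : t0 + u = t0 + m by apply: e; rewrite [X in `|X|](_ : _ = u - m); [lra|ring].
  by move=> /addrI um; move: hu; rewrite um subrr normr0 ltxx.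
have : limit_points Z (cis (t0 + m)) by [].
rewrite -haZ => -[j _ ej].
have hm' : 0 <= m < tau by have := alpha_ord i; have := alpha_range (ltn_ord i); lra.
have em : m = alpha j by rewrite -angle_a ej angle_cis.
have [ij|ji] := ltnP i j.
  by have := @alpha_le i.+1 j; rewrite ij ltnW // => /(_ isT); lra.
by have := @alpha_le j i; rewrite ji ltnW // => /(_ isT); lra.
Qed.

Lemma succ_inP i z : Z z -> in_segment i z ->
  [/\ Z (succ_in Z z), in_segment i (succ_in Z z), th z < th (succ_in Z z)
    & forall w, Z w -> ~ th z < th w < th (succ_in Z z)].
Proof.
move=> Zz iz; have /andP[iz1 iz2] := iz.
have [|u [hu Zu uN]] := first_point (@Z_locally_discrete i) iz1.
  have [w [Zw /andP[_ iw] zw]] := Z_near_right iz2.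
  by exists (th w); [rewrite zw|have [_ <-] := angleZ Zw].
have iu : in_segment i (cis (t0 + u)) by apply: cis_in_segment; lra.
have thu : th (cis (t0 + u)) = u.
  by rewrite angle_cis; have := alpha_range (ltn_ord i); have := alpha_ord i; lra.
have between w : Z w -> ~ th z < th w < u.
  by move=> Zw hw; apply: (uN _ hw); have [_ <-] := angleZ Zw.
suff -> : succ_in Z z = cis (t0 + u) by rewrite thu; split=> //; lra.
rewrite /succ_in; case: xgetP => [w _ [Zw wz wN]|/(_ (cis (t0 + u)))[]]; last first.
  split=> // [e|w Zw]; first by move: thu; rewrite e; lra.
  rewrite ccwZ; [|exact: Z_circle..]; rewrite thu /cyclic3 => hw.
  by apply: (between w Zw); lra.
(* If the chosen [w] differed from the first point after [z], one of the two would lie cyclically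
   between [z] and the other. *)
apply: angle_inj; [exact: Z_circle..|rewrite thu].
have wz' : th w <> th z by move=> e; apply: wz; apply: angle_inj => //; exact: Z_circle.
have := wN _ Zu; have := between w Zw.
rewrite ccwZ; [|exact: Z_circle..]; rewrite thu /cyclic3 => h1 h2.
by case: (ltgtP (th w) u) => // ?; exfalso;
  [case: (ltgtP (th w) (th z)) => // ?; apply: h1 || apply: h2|apply: h2]; lra.
Qed.

Lemma pred_inP i z : Z z -> in_segment i z ->
  [/\ Z (pred_in Z z), in_segment i (pred_in Z z), th (pred_in Z z) < th z
    & forall w, Z w -> ~ th (pred_in Z z) < th w < th z].
Proof.
move=> Zz iz; have /andP[iz1 iz2] := iz.
have [|u [hu Zu uN]] := last_point (@Z_locally_discrete i) iz2.
  have [w [Zw /andP[iw _] zw]] := Z_near_left iz1.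
  by exists (th w); [rewrite iw|have [_ <-] := angleZ Zw].
have iu : in_segment i (cis (t0 + u)) by apply: cis_in_segment; lra.
have thu : th (cis (t0 + u)) = u.
  by rewrite angle_cis; have := alpha_range (ltn_ord i); have := alpha_ord i; lra.
have between w : Z w -> ~ u < th w < th z.
  by move=> Zw hw; apply: (uN _ hw); have [_ <-] := angleZ Zw.
suff -> : pred_in Z z = cis (t0 + u) by rewrite thu; split=> //; lra.
rewrite /pred_in; case: xgetP => [w _ [Zw wz wN]|/(_ (cis (t0 + u)))[]]; last first.
  split=> // [e|w Zw]; first by move: thu; rewrite e; lra.
  rewrite ccwZ; [|exact: Z_circle..]; rewrite thu /cyclic3 => hw.
  by apply: (between w Zw); lra.
apply: angle_inj; [exact: Z_circle..|rewrite thu].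
have wz' : th w <> th z by move=> e; apply: wz; apply: angle_inj => //; exact: Z_circle.
have := wN _ Zu; have := between w Zw.
rewrite ccwZ; [|exact: Z_circle..]; rewrite thu /cyclic3 => h1 h2.
by case: (ltgtP (th w) u) => // ?; exfalso;
  [apply: h2|case: (ltgtP (th w) (th z)) => // ?; apply: h1 || apply: h2]; lra.
Qed.

Lemma crossingZ s0 s1 w0 w1 : Z s0 -> Z s1 -> Z w0 -> Z w1 ->
  crossing s0 s1 w0 w1 <->
  [&& th s0 != th w0, th s0 != th w1, th s1 != th w0, th s1 != th w1
    & (th s0 < th w0) (+) (th s0 < th w1) != (th s1 < th w0) (+) (th s1 < th w1)].
Proof.
move=> /Z_circle c1 /Z_circle c2 /Z_circle c3 /Z_circle c4.
by rewrite -cyclic4P /crossing /ccw4 !ccwZ.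
Qed.

Lemma pred_succ z : Z z -> pred_in Z (succ_in Z z) = z.
Proof.
move=> Zz; have [i iz] := Z_in_segment Zz.
have [Zs is_ zs sN] := succ_inP Zz iz.
have [Zp ip ps pN] := pred_inP Zs is_.
apply: angle_inj; [exact: Z_circle..|].
case: (ltgtP (th (pred_in Z (succ_in Z z))) (th z)) => // h.
- by case: (pN z Zz); rewrite h zs.
- by case: (sN _ Zp); rewrite h ps.
Qed.

Lemma succ_pred z : Z z -> succ_in Z (pred_in Z z) = z.
Proof.
move=> Zz; have [i iz] := Z_in_segment Zz.
have [Zp ip pz pN] := pred_inP Zz iz.
have [Zs is_ ps sN] := succ_inP Zp ip.
apply: angle_inj; [exact: Z_circle..|].
case: (ltgtP (th (succ_in Z (pred_in Z z))) (th z)) => // h.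
- by case: (pN _ Zs); rewrite h ps.
- by case: (sN z Zz); rewrite h pz.
Qed.

Lemma Z_succ z : Z z -> Z (succ_in Z z).
Proof. by move=> Zz; have [i /(succ_inP Zz)[]] := Z_in_segment Zz. Qed.

Lemma is_arc_succ z0 z1 : is_arc Z z0 z1 -> is_arc Z (succ_in Z z0) (succ_in Z z1).
Proof.
move=> [Z0 Z1 [np n1 ns]]; split; [exact: Z_succ..|split].
- by rewrite pred_succ // => e; apply: np; rewrite -e pred_succ.
- by move=> /(congr1 (pred_in Z)); rewrite !pred_succ.
- by move=> /(congr1 (pred_in Z)); rewrite !pred_succ //; exact: Z_succ.
Qed.

Lemma is_arc_pred_succ z : Z z -> is_arc Z (pred_in Z z) (succ_in Z z).
Proof.
move=> Zz; have [i iz] := Z_in_segment Zz.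
have [Zp ip pz _] := pred_inP Zz iz; have [Zs is_ zs _] := succ_inP Zz iz.
have [_ _ ppp _] := pred_inP Zp ip.
split=> //; rewrite succ_pred //; split.
- by move=> e; move: zs; rewrite e; lra.
- by move=> e; move: zs; rewrite e; lra.
- by move=> e; move: zs; rewrite e ltxx.
Qed.

Lemma is_arc_segments i j z w : Z z -> Z w -> in_segment i z -> in_segment j w ->
  i != j -> is_arc Z z w.
Proof.
move=> Zz Zw iz jw /eqP ij.
have [_ ip _ _] := pred_inP Zz iz; have [_ is_ _ _] := succ_inP Zz iz.
split=> //; split=> e; apply: ij; rewrite e in jw; exact: in_segment_uniq jw.
Qed.

(** * Decorations and the arcs orthogonal to the aisle *)

Context {P : {set {set 'I_n}}} {x : 'I_n -> R * R} {xi : 'I_n -> R}.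
Hypotheses (hP : noncrossing P) (hx : decoration Z a P x).

Lemma decoration_closure i : closure Z (x i).
Proof. by have := hx i; case: ifP => _; [|case: ifP => _]; case. Qed.

(** The angle is chosen in the closed segment rather than by [angle t0], which would give 0 instead
    of [tau] when the last decoration is the right end. *)
Lemma decoration_angle i : exists u, [/\ alpha i <= u <= alpha i.+1, x i = cis (t0 + u)
  & u = alpha i -> is_singleton P i].
Proof.
have [aE _ _ _] := ha; have [iS hi] := alpha_ord i.
have hS := alpha_range (ltn_ord i); have iw := alpha_width i.
have oo : ccw (a i) (x i) (a (ordS i)) -> exists u, [/\ alpha i <= u <= alpha i.+1,
    x i = cis (t0 + u) & u = alpha i -> is_singleton P i].
  move=> c; have xc : circle (x i).
    by have [t [u [v [_ -> _ _]]]] := c; exact: cos2Dsin2.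
  have [hu xE] := circle_angle t0 xc.
  have := c; rewrite aE aSE [X in ccw _ X _]xE ccw_between //; try lra.
  by move=> h; exists (th (x i)); split=> //; lra.
have := hx i; move: oo; case: ifPn => [s|_] oo.
  move=> [_ _ [/oo//|->]]; exists (alpha i); split; [lra|exact: aE|by []].
case: ifPn => _ => [[_ _ [/oo//|->]]|[_ /oo//]].
by exists (alpha i.+1); split; [lra|exact: aSE|lra].
Qed.

Hypothesis hxi : forall i, [/\ alpha i <= xi i <= alpha i.+1, x i = cis (t0 + xi i)
  & xi i = alpha i -> is_singleton P i].

Lemma a_neq_aS i : a i <> a (ordS i).
Proof.
have [aE _ _ _] := ha; rewrite aE aSE => /cis_inj; rewrite ltr_norml.
have [iS hi] := alpha_ord i; have := alpha_width i => iw.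
by move=> /(_ ltac:(lra)); lra.
Qed.

Lemma xi_Z i : Z (x i) -> alpha i < xi i < alpha i.+1.
Proof.
have [hi xE _] := hxi i => Zx; rewrite !lt_neqAle; have [h1 h2] := andP hi.
have [aE _ _ _] := ha.
rewrite h1 h2 !andbT; apply/andP; split; apply/eqP => e.
- by apply: (@not_Z_a i); rewrite aE e -xE.
- by apply: (@not_Z_a (ordS i)); rewrite aSE -e -xE.
Qed.

Lemma xi_not_Z i : ~ Z (x i) -> xi i = alpha i \/ xi i = alpha i.+1.
Proof.
move=> nZ; have [hi xE _] := hxi i.
have : limit_points Z (x i) by split=> //; exact: decoration_closure.
rewrite -haZ => -[j _ ej].
have [e1|/eqP n1] := eqVneq (xi i) (alpha i); first by left.
have [e2|/eqP n2'] := eqVneq (xi i) (alpha i.+1); first by right.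
have xin : alpha i < xi i < alpha i.+1.
  by rewrite !lt_neqAle eq_sym; move/eqP: n1 => ->; move/eqP: n2' => ->.
have [_ hi'] := alpha_ord i; have hS := alpha_range (ltn_ord i).
have em : xi i = alpha j by rewrite -angle_a ej xE angle_cis //; lra.
exfalso; have [ij|ji] := ltnP i j.
- by have := @alpha_le i.+1 j; rewrite ij ltnW // => /(_ isT); lra.
- by have := @alpha_le j i; rewrite ji ltnW // => /(_ isT); lra.
Qed.

Lemma angle_x i : Z (x i) -> th (x i) = xi i.
Proof.
move=> Zx; have hxi' := xi_Z Zx; have [_ xE _] := hxi i.
have [_ hi] := alpha_ord i; have hS := alpha_range (ltn_ord i).
by rewrite xE angle_cis //; lra.
Qed.

Lemma int_oc_angle i z : Z z ->
  int_oc Z (a i) (x i) z <-> alpha i < th z <= xi i.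
Proof.
move=> Zz; have [hi xE _] := hxi i; have [aE _ _ _] := ha.
have [iS hi'] := alpha_ord i; have hS := alpha_range (ltn_ord i).
have [hz zE] := angleZ Zz; have iw := alpha_width i.
split=> [[_ ax]|hzi].
  have axi : alpha i < xi i.
    rewrite lt_neqAle; apply/andP; split; last by lra.
    by apply/eqP => e; apply: ax; rewrite aE e -xE.
  case=> [|ez]; last by rewrite ez in Zz *; rewrite angle_x // axi lexx.
  by rewrite aE xE zE ccw_between ?angle_cis //; lra.
split; first exact: subset_closure.
- rewrite aE xE => /cis_inj; rewrite ltr_norml.
  by move=> /(_ ltac:(lra)); lra.
- have [e|/eqP ne] := eqVneq (th z) (xi i); [right|left].
    by rewrite xE -e.
  by rewrite aE xE zE ccw_between; lra.
Qed.

(** If [x i] is in [Z], then [z] is at or after its predecessor exactly when the successor of [z] is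
    at or after [x i]. If [x i = a i], the inequality is automatic on the segment; if [x i] is the
    right end, both sides are empty. *)
Lemma int_co_angle i z : Z z ->
  int_co Z (if x i \in Z then pred_in Z (x i) else x i) (a (ordS i)) z <->
  in_segment i z /\ xi i <= th (succ_in Z z).
Proof.
move=> Zz; have [hi xE _] := hxi i; have [aE _ _ _] := ha.
have [iS hi'] := alpha_ord i; have hS := alpha_range (ltn_ord i).
have [hz zE] := angleZ Zz; have iw := alpha_width i.
have clz : closure Z z by exact: subset_closure.
case: ifPn => [/set_mem Zx|/negP nZx]; last first.
  have {}nZx : ~ Z (x i) by move=> Zx; apply/nZx/mem_set.
  have [e|e] := xi_not_Z nZx.
    have -> : x i = a i by rewrite xE e aE.
    split=> [[_ _ [|za]]|[iz _]].
    - move=> h; have iz : in_segment i z.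
        by move: h; rewrite aE aSE [X in ccw _ X]zE ccw_between /in_segment //; lra.
      by split=> //; have [_ /andP[+ _] _ _] := succ_inP Zz iz; lra.
    - by case: (@not_Z_a i); rewrite -za.
    - split=> //; first exact: a_neq_aS.
      by left; rewrite aE aSE [X in ccw _ X]zE ccw_between //; lra.
  have -> : x i = a (ordS i) by rewrite xE e aSE.
  split=> [[_ []//]|[iz]].
  by have [_ /andP[_ +] _ _] := succ_inP Zz iz; lra.
have xin := xi_Z Zx; have ix : in_segment i (x i) by rewrite /in_segment angle_x.
have [Zp ip px pN] := pred_inP Zx ix; rewrite angle_x // in px pN.
have [hp pE] := angleZ Zp; move/andP: (ip) => [ip1 ip2].
split=> [[_ _ h]|[iz xz]].
  have {}h : th (pred_in Z (x i)) <= th z < alpha i.+1.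
    case: h => [|->]; last by rewrite lexx.
    by rewrite {1}pE aSE {1}zE ccw_between; lra.
  have iz : in_segment i z by rewrite /in_segment; lra.
  split=> //; have [Zs _ zs _] := succ_inP Zz iz.
  by have := pN _ Zs => ?; rewrite leNgt; apply/negP => ?; lra.
have [Zs _ zs sN] := succ_inP Zz iz.
move/andP: (iz) => [iz1 iz2].
have pz : th (pred_in Z (x i)) <= th z.
  by have := sN _ Zp => ?; rewrite leNgt; apply/negP => ?; lra.
split=> //.
  by move=> e; apply: (@not_Z_a (ordS i)); rewrite -e.
have [e|/eqP ne] := eqVneq (th z) (th (pred_in Z (x i))); [right|left].
  by apply: angle_inj e; exact: Z_circle.
by rewrite [X in ccw X]pE aSE [X in ccw _ X]zE ccw_between; lra.
Qed.

Lemma is_arc_sym z w : is_arc Z z w -> is_arc Z w z.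
Proof.
move=> [Zz Zw [np ne ns]]; split=> //; split=> e.
- by apply: ns; rewrite e succ_pred.
- exact: ne.
- by apply: np; rewrite e pred_succ.
Qed.

Lemma crossing_sym s0 s1 w0 w1 : crossing s0 s1 w0 w1 -> crossing s0 s1 w1 w0.
Proof. by case; [right|left]. Qed.

(** Only singletons may be decorated by their left end, so in a larger block each [(a_j, x_j]]
    contains points of [Z]. *)
Lemma xi_block B j k : B \in P -> j \in B -> k \in B -> j != k -> alpha j < xi j.
Proof.
move=> BP jB kB jk; have [hj _ js] := hxi j.
rewrite lt_neqAle; have [-> _] := andP hj; rewrite andbT.
apply/eqP => /esym/js sj; have [/and3P[_ tP _] _] := andP hP.
move: kB; rewrite -(def_pblock tP BP jB) (def_pblock tP sj (set11 j)) inE.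
by rewrite eq_sym (negPf jk).
Qed.

Lemma arc_in_block (B : {set 'I_n}) s0 s1 : Z s0 -> Z s1 ->
  [set s0; s1] `<=` \bigcup_(i in [set` B]) int_oc Z (a i) (x i) <->
  exists j k, [/\ j \in B, k \in B, alpha j < th s0 <= xi j & alpha k < th s1 <= xi k].
Proof.
move=> Z0 Z1; split=> [sub|[j [k [jB kB hj hk]]] s].
  have [j /= jB /(int_oc_angle _ Z0) hj] := sub s0 (or_introl erefl).
  have [k /= kB /(int_oc_angle _ Z1) hk] := sub s1 (or_intror erefl).
  by exists j, k.
by case=> ->; [exists j|exists k] => //; exact/int_oc_angle.
Qed.

Lemma xi_segment j s : Z s -> alpha j < th s <= xi j -> in_segment j s.
Proof.
move=> Zs /andP[js sx]; have [/andP[_ xS] _ _] := hxi j.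
rewrite /in_segment js lt_neqAle (le_trans sx xS) andbT; apply/eqP => e.
have [_ sE] := angleZ Zs.
by apply: (@not_Z_a (ordS j)); rewrite aSE -e -sE.
Qed.

(** Distinct segments are ordered by their indices; within one segment the decoration lies between
    [s] and [w]. *)
Lemma below_above i j s w : Z s -> Z w -> alpha j < th s <= xi j ->
  in_segment i w -> xi i <= th w -> th s != th w -> (th s < th w) = (j <= i)%N.
Proof.
move=> Zs Zw hs iw xw sw; have js := xi_segment Zs hs.
have [ji|ij|e] := ltngtP j i.
- exact: in_segment_lt js iw ji.
- by apply/negbTE; rewrite -leNgt ltW // (in_segment_lt iw js ij).
- rewrite lt_neqAle sw; move: hs; rewrite (val_inj e) => /andP[_ h].
  exact: le_trans h xw.
Qed.

Section NoCrossing.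
Variables (w0 w1 : R * R).
Hypotheses (arcw : is_arc Z w0 w1)
  (ncross : forall s0 s1, is_arc Z s0 s1 ->
    (exists2 B, B \in P & [set s0; s1] `<=` \bigcup_(i in [set` B]) int_oc Z (a i) (x i)) ->
    ~ crossing s0 s1 w0 w1).

(** Otherwise the arc joining the two neighbours of [w0] lies in the aisle, and it crosses every arc
    ending at [w0]. *)
Lemma no_crossing_above i : in_segment i w0 -> xi i <= th w0.
Proof.
have [Z0 Z1 [np ne ns]] := arcw => i0; rewrite leNgt; apply/negP => wx.
have [Zp ip pw pN] := pred_inP Z0 i0; have [Zs is_ ws sN] := succ_inP Z0 i0.
have sx : th (succ_in Z w0) <= xi i.
  (* If [x i] is in [Z], the successor of [w0] cannot jump over it; otherwise [xi i] is an end of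
     the segment containing both points. *)
  have [Zx|nZx] := pselect (Z (x i)).
    rewrite leNgt; apply/negP => xs; apply: (sN _ Zx).
    by rewrite angle_x // wx xs.
  move: (i0) (is_); rewrite /in_segment.
  by case: (xi_not_Z nZx) wx => ->; lra.
have [iP ii] := pblock_mem_noncrossing hP i.
apply: (ncross (is_arc_pred_succ Z0)).
  exists (finset.pblock P i) => //; apply/arc_in_block => //.
  by exists i, i; split=> //; move: (ip) (is_); rewrite /in_segment; lra.
apply/crossingZ => //.
have th_neq p q : Z p -> Z q -> p <> q -> th p != th q.
  by move=> Zp' Zq' pq; apply/eqP => e; apply: pq; apply: angle_inj e; exact: Z_circle.
have n1 := th_neq _ _ Z1 Zp np; have n2' := th_neq _ _ Z1 Z0 ne.
have n3 := th_neq _ _ Z1 Zs ns; have := pN _ Z1; have := sN _ Z1.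
move=> h4 h5; apply/and5P; split; first by rewrite lt_eqF.
- by rewrite eq_sym.
- by rewrite gt_eqF.
- by rewrite eq_sym.
rewrite pw [th (succ_in Z w0) < th w0]ltNge (ltW ws) /=.
move: n1 n2' n3; case: (ltgtP (th w1) (th w0)) => // h1 h2 _ h3.
- have -> : (th (succ_in Z w0) < th w1) = false by apply/negbTE; rewrite -leNgt; lra.
  have -> // : (th (pred_in Z w0) < th w1) = false.
  by apply/negbTE; rewrite -leNgt; lra.
- have -> : (th (pred_in Z w0) < th w1) = true by lra.
  have -> // : (th (succ_in Z w0) < th w1) = true.
  by move: h3; case: ltgtP => // ? _; exfalso; apply: h4; rewrite h1.
Qed.

End NoCrossing.

Lemma orthogonal_arcP z0 z1 : is_arc Z z0 z1 ->
  (forall s0 s1, is_arc Z s0 s1 ->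
    (exists2 B, B \in P & [set s0; s1] `<=` \bigcup_(i in [set` B]) int_oc Z (a i) (x i)) ->
    ~ crossing s0 s1 (succ_in Z z0) (succ_in Z z1)) <->
  exists2 B, B \in kreweras P & [set z0; z1] `<=` \bigcup_(i in [set` B])
    int_co Z (if x i \in Z then pred_in Z (x i) else x i) (a (ordS i)).
Proof.
move=> arcz; have arcw := is_arc_succ arcz.
have [Z0 Z1 _] := arcz; have [W0 W1 _] := arcw.
split=> [ncross|].
  have [i0 s0] := Z_in_segment Z0; have [i1 s1] := Z_in_segment Z1.
  have [_ t0' _ _] := succ_inP Z0 s0; have [_ t1' _ _] := succ_inP Z1 s1.
  have x0 := no_crossing_above arcw ncross t0'.
  have x1 : xi i1 <= th (succ_in Z z1).
    apply: no_crossing_above (is_arc_sym arcw) _ _ t1' => u v arcuv uvB /crossing_sym.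
    exact: ncross.
  suff /(krewerasP hP)[B BK /andP[i0B i1B]] : unseparated P i0 i1.
    exists B => // z [] ->; [exists i0|exists i1] => //; exact/int_co_angle.
  apply/unseparatedP => B j k BP jB kB.
  have [->|jk] := eqVneq j k; first by rewrite !addbb.
  have below (l : 'I_n) : alpha l < xi l -> exists z, [/\ Z z, in_segment l z & th z < xi l].
    exact: Z_near_left.
  (* The test arc [{u, v}] has its endpoints in segments [j] and [k], strictly below the
     decorations, hence distinct from both successors. *)
  have [u [Zu ju ux]] := below j (xi_block BP jB kB jk).
  have [v [Zv kv vx]] : exists z, [/\ Z z, in_segment k z & th z < xi k].
    by apply: below; apply: xi_block BP kB jB _; rewrite eq_sym.
  have hu : alpha j < th u <= xi j by move: (ju); rewrite /in_segment; lra.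
  have hv : alpha k < th v <= xi k by move: (kv); rewrite /in_segment; lra.
  have neq (l i : 'I_n) p w : in_segment l p -> th p < xi l ->
      in_segment i w -> xi i <= th w ->
      th p != th w.
    move=> lp px iw xw; apply/eqP => e.
    have li : l = i.
      by apply: in_segment_uniq lp _; rewrite /in_segment e.
    by move: xw; rewrite -li -e; lra.
  have nu0 := neq _ _ _ _ ju ux t0' x0; have nu1 := neq _ _ _ _ ju ux t1' x1.
  have nv0 := neq _ _ _ _ kv vx t0' x0; have nv1 := neq _ _ _ _ kv vx t1' x1.
  have := ncross u v (is_arc_segments Zu Zv ju kv jk).
  move=> /(_ (ex_intro2 _ _ B BP (proj2 (arc_in_block B Zu Zv) _))) nc.
  (* Once [below_above] turns angles into indices, the parity condition for a crossing is a
     rearrangement of the negated equation in [unseparated]. *)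
  apply/eqP; apply: contra_notT (nc _); last by exists j, k.
  rewrite crossingZ // nu0 nu1 nv0 nv1 /=.
  rewrite (below_above Zu W0 hu t0' x0) // (below_above Zu W1 hu t1' x1) //.
  rewrite (below_above Zv W0 hv t0' x0) // (below_above Zv W1 hv t1' x1) //.
  by case: (j <= i0)%N (j <= i1)%N (k <= i0)%N (k <= i1)%N => -[] [] [].
(* Conversely, an assumed crossing supplies the distinctness required by [below_above], and its
   parity condition contradicts [unseparated]. *)
move=> [B BK sub] u v [Zu Zv _] [A AP /arc_in_block[]// j [k [jA kA hu hv]]].
have [i0 /= i0B /(int_co_angle _ Z0)[s0 x0]] := sub z0 (or_introl erefl).
have [i1 /= i1B /(int_co_angle _ Z1)[s1 x1]] := sub z1 (or_intror erefl).
have /unseparatedP/(_ A j k AP jA kA) sep : unseparated P i0 i1.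
  by apply/(krewerasP hP); exists B => //; rewrite i0B.
have [_ t0' _ _] := succ_inP Z0 s0; have [_ t1' _ _] := succ_inP Z1 s1.
rewrite crossingZ // => /and5P[n1 n2' n3 n4].
rewrite (below_above Zu W0 hu t0' x0) // (below_above Zu W1 hu t1' x1) //.
rewrite (below_above Zv W0 hv t0' x0) // (below_above Zv W1 hv t1' x1) //.
by case: (j <= i0)%N (j <= i1)%N (k <= i0)%N (k <= i1)%N sep => -[] [] [].
Qed.

End Segments.

(** * Coaisles in terms of arcs *)

Section DiscreteClusterCategory.
Context {R : realType} {Z : set (R * R)} {K : fieldType}.
Context (C : discrete_cluster_category Z K).

Lemma dim_fullv_eq0 (V : vectType K) :
  \dim {: V} = 0%N <-> forall v : V, v = 0.
Proof.
split=> [/eqP|v0].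
  by rewrite dimv_eq0 => /eqP V0 v; apply/eqP; rewrite -memv0 -V0 memvf.
by apply/eqP; rewrite dimv_eq0 -subv0; apply/subvP => v _; rewrite (v0 v) mem0v.
Qed.

(** An object of [Y] is a sum of objects isomorphic to arcs, each of which inherits orthogonality
    through its inclusion; conversely the arcs of [G] lie in the subcategory [Y]. *)
Lemma coaisle_add_arcs (X Y : C -> Prop) (F G : set (set (R * R))) :
  torsion_pair X Y -> (forall T, X T <-> add_arcs F T) ->
  (forall A, G A <-> arcs Z A /\ forall S, F S ->
     forall f : Defs.hom (arc_obj C S) (arc_obj C A), f = 0) ->
  forall T, Y T <-> add_arcs G T.
Proof.
move=> XY XF GE; have [_ Ysub _ _] := XY.
have orth T : Y T <-> forall S, F S -> forall f : Defs.hom (arc_obj C S) T, f = 0.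
  rewrite (coaisle_orthogonal XY); split=> h S FS.
    by apply/h/XF => S' _; apply.
  exact: (proj1 (XF S) FS _ (orthogonal_subcategory T)).
move=> T; split=> [YT S Ssub SG|].
  have [m [U [TU locU]]] := dcat_ks T.
  apply: (subcategory_dsum Ssub TU) => i.
  have [A AZ UA] := arc_obj_surj (local_end_indecomposable (locU i)).
  have [N N0] := zero_ex C.
  apply: (subcategory_iso N0 Ssub (isomorphic_sym UA)).
  apply/SG/GE; split=> // S' FS'.
  have idS : isomorphic (arc_obj C S') (arc_obj C S').
    by exists (idm _), (idm _); rewrite comp1m.
  apply: (hom_iso_eq0 idS UA) => f.
  have [inj [prj [prj_inj _ _]]] := TU.
  rewrite -(comp1m f) -(prj_inj i) -Defs.compA.
  by rewrite (proj1 (orth T) YT S' FS' (inj i ⊚ f)) comp0.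
apply=> // A /GE[_ A0]; exact/orth.
Qed.

(** The target is the suspension of the arc of successors, so the description of morphisms by
    crossings applies. *)
Lemma hom_arc_eq0 s0 s1 z0 z1 : is_arc Z s0 s1 ->
  is_arc Z (succ_in Z z0) (succ_in Z z1) ->
  pred_in Z (succ_in Z z0) = z0 -> pred_in Z (succ_in Z z1) = z1 ->
  (forall f : Defs.hom (arc_obj C [set s0; s1]) (arc_obj C [set z0; z1]), f = 0) <->
  ~ crossing s0 s1 (succ_in Z z0) (succ_in Z z1).
Proof.
move=> arcs arcw e0 e1.
have := arc_obj_sh C arcw; rewrite e0 e1 => shz.
have idS : isomorphic (arc_obj C [set s0; s1]) (arc_obj C [set s0; s1]).
  by exists (idm _), (idm _); rewrite comp1m.
split=> [h cr|ncr].
  have := hom_crossing C arcs arcw cr.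
  suff /dim_fullv_eq0 -> : forall f : Defs.hom (arc_obj C [set s0; s1])
    (sh (arc_obj C [set succ_in Z z0; succ_in Z z1])), f = 0 by [].
  exact: (hom_iso_eq0 idS (isomorphic_sym shz)).
apply: (hom_iso_eq0 idS shz); apply/dim_fullv_eq0.
exact: hom_not_crossing.
Qed.

End DiscreteClusterCategory.

Theorem corollary4p14 (R : realType) (K : fieldType) (n : nat) (hn : (2 <= n)%N)
    (Z : set (R * R)%type) (hZ : admissible Z)
    (a : 'I_n -> (R * R)%type) (ha : cyclically_ordered a)
    (haZ : range a = limit_points Z)
    (C : discrete_cluster_category Z K)
    (X Y : C -> Prop) (hXY : t_structure X Y)
    (P : {set {set 'I_n}}) (hP : noncrossing P)
    (x : 'I_n -> (R * R)%type) (hx : decoration Z a P x)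
    (hX : forall T : C,
        X T <-> add_arcs (arcs_in_blocks Z P (fun i => int_oc Z (a i) (x i))) T) :
  let y := fun i : 'I_n => if x i \in Z then pred_in Z (x i) else x i in
  forall T : C,
    Y T <-> add_arcs (arcs_in_blocks Z (kreweras P)
                        (fun i => int_co Z (y i) (a (ordS i)))) T.
Proof.
move=> y.
(* The circle is closed, so it contains the closure of [Z]. *)
have acirc i : circle (a i).
  have [Zc _ _ _ _] := hZ; apply: closed_circle.
  have [cl _] : limit_points Z (a i) by rewrite -haZ; exists i.
  exact: closure_subset Zc _ cl.
have [t0 [alpha aang]] := exists_angles hn ha acirc.
have [xi xiP] := choice (decoration_angle hn aang hx).
have [tXY _] := hXY.
apply: (coaisle_add_arcs tXY hX) => A.
have homP s0 s1 z0 z1 (arcs : is_arc Z s0 s1) (arcz : is_arc Z z0 z1) :=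
  let: And3 Z0 Z1 _ := arcz in
  hom_arc_eq0 C arcs (is_arc_succ hZ haZ hn aang arcz)
    (pred_succ hZ haZ hn aang Z0) (pred_succ hZ haZ hn aang Z1).
split=> [[[z0 [z1 [arcz ->]]] AB]|[[z0 [z1 [arcz ->]]] A0]].
  split=> [|S [[s0 [s1 [arcs ->]]] SB]]; first by exists z0, z1.
  apply/(homP _ _ _ _ arcs arcz).
  exact: (proj2 (orthogonal_arcP hZ haZ hn aang hP hx xiP arcz)).
split; first by exists z0, z1.
apply/(orthogonal_arcP hZ haZ hn aang hP hx xiP arcz) => s0 s1 arcs SB.
apply/(homP _ _ _ _ arcs arcz).
by apply: A0; split=> //; exists s0, s1.
Qed.
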